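(* Let $X$ be a metric space which is an algebraic $ANR_G$. Then for every open cover $\mathcal U$ of $X$ there is an open cover $\mathcal V$ of $X$ refining $\mathcal U$ such that the following holds. Let $Y$ be an arbitrary space, $A\subset Y$ a closed set, $\varphi,\phi:S(Y;G)\to S(X;G)$ two correct $\mathcal V$-close chain morphisms, and $D:S(A;G)\to S(X;G)$ a $\mathcal V$-small chain homotopy between $\varphi|S(A;G)$ and $\phi|S(A;G)$. Then there exists a $\mathcal U$-small chain homotopy $\Phi:S(Y;G)\to S(X;G)$ between $\varphi$ and $\phi$ such that $\Phi(c)=D(c)$ for all $c\in S(A;G)$.
   Context: Conventions: all spaces are paracompact; $G$ is a commutative ring with unit. A chain complex is a sequence $C=\{C_k\}_{k\ge 0}$ of $G$-modules with boundary homomorphisms $\partial$ satisfying $\partial\partial=0$; a chain morphism is a sequence of homomorphisms (degree by degree) commuting with the boundaries and, in degree $0$, with the augmentations. $S(X;G)=\{S_k(X;G)\}_{k\ge0}$ is the singular chain complex of $X$ with coefficients in $G$. For a simplicial complex $K$, $C(K;G)$ is its oriented chain complex and $K^{(0)}$ its vertex set. The carrier of a singular simplex $\sigma:\triangle^k\to X$ is $|\sigma|=\sigma(\triangle^k)$; for a chain $c=\sum_i g_i\sigma_i$ (irreducible representation) $|c|=\bigcup_i|\sigma_i|$, and $|0|=\varnothing$. A face of $\sigma:\triangle^k\to X$ is the restriction of $\sigma$ to a face of $\triangle^k$; a vertex of $\sigma$ is the singular $0$-simplex obtained by restricting $\sigma$ to a vertex of $\triangle^k$. A chain morphism $\varphi:S(Y;G)\to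 S(X;G)$ (resp. $\varphi:C(K;G)\to S(X;G)$) is correct if $\varphi(\sigma)$ is a singular $0$-simplex of $X$ for every singular $0$-simplex $\sigma$ of $Y$ (resp. $\varphi(v)$ is a singular $0$-simplex for every vertex $v$ of $K$). Given an open cover $\mathcal U$ of $X$, chain morphisms $\varphi,\phi:S(Y;G)\to S(X;G)$ are $\mathcal U$-close if for each singular simplex $\sigma$ of $Y$ there is $U_\sigma\in\mathcal U$ with $|\varphi(\tau)|\cup|\phi(\tau)|\subset U_\sigma$ for all faces $\tau$ of $\sigma$. A chain homotopy $D:S(Y;G)\to S(X;G)$ between chain morphisms $\varphi$ and $\phi$ is a sequence of homomorphisms $D_k:S_k(Y;G)\to S_{k+1}(X;G)$, $k\ge0$, with $\partial D_0(\sigma)=\varphi(\sigma)-\phi(\sigma)$ for singular $0$-simplexes $\sigma$ and $\partial D_k(\sigma)=\varphi(\sigma)-\phi(\sigma)-D_{k-1}(\partial\sigma)$ for singular $k$-simplexes $\sigma$, $k\ge1$. It is $\mathcal U$-small if for every singular simplex $\sigma$ of $Y$ there is $U_\sigma\in\mathcal U$ with $|D(\tau)|\cup|\varphi(v)|\cup|\phi(v)|\subset U_\sigma$ for all faces $\tau$ of $\sigma$ and all vertices $v$ of $\sigma$. Algebraic realizations: for a simplicial complex $K$ and an open cover $\mathcal U$ of $X$, a chain morphism $\varphi:C(L;G)\to S(X;G)$ is a partial algebraic realization of $C(K;G)$ in $\mathcal U$ if $L$ is a subcomplex of $K$ containing $K^{(0)}$ and for every simplex $\sigma\in K$ there is $U_\sigma\in\mathcal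 U$ with $|\varphi(\tau)|\subset U_\sigma$ for all faces $\tau$ of $\sigma$ with $\tau\in L$; it is a full algebraic realization if $L=K$. A metric space $X$ is an algebraic $ANR_G$ (absolute neighborhood algebraic $G$-retract) if for every open cover $\mathcal U$ of $X$ there is an open cover $\mathcal V$ refining $\mathcal U$ such that, for any simplicial complex $K$, any correct partial algebraic realization of $C(K;G)$ in $\mathcal V$ extends to a full algebraic realization of $C(K;G)$ in $\mathcal U$. *)

(* Defs.v *)
From HB Require Import structures.
From mathcomp Require Import all_boot all_order all_algebra fingroup perm.
From mathcomp Require Import finmap generic_quotient ring_quotient.
From mathcomp Require Import all_classical reals topology.
From mathcomp Require Import monalg zify.

Set Implicit Arguments.
Unset Strict Implicit.
Unset Printing Implicit Defensive.

Import Order.TTheory GRing.Theory Num.Theory.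
Import numFieldTopology.Exports.

Local Open Scope classical_set_scope.
Local Open Scope ring_scope.

(* ------------------------------------------------------------------------ *)

Definition open_cover (X : topologicalType) (U : set (set X)) : Prop :=
  (forall A, U A -> open A) /\ (forall x, exists2 A, U A & A x).

Definition refines (X : Type) (V U : set (set X)) : Prop :=
  forall B, V B -> exists2 A, U A & B `<=` A.

Definition locally_finite (X : topologicalType) (V : set (set X)) : Prop :=
  forall x : X, exists2 N, nbhs x N & finite_set [set B | V B /\ B `&` N !=set0].

(* The Hausdorff property is not part of the definition. *)
Definition paracompact (X : topologicalType) : Prop :=
  forall U : set (set X), open_cover U ->
  exists V, [/\ open_cover V, refines V U & locally_finite V].

(* ------------------------------------------------------------------------ *)

Section LinearExtension.
Variables (G : comNzRingType) (T : choiceType) (M : lmodType G) (f : T -> M).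

Definition linext (c : {malg G[T]}) : M := \sum_(x <- msupp c) c@_x *: f x.

Lemma linextEw (c : {malg G[T]}) (E : {fset T}) :
  (msupp c `<=` E)%fset -> linext c = \sum_(x <- E) c@_x *: f x.
Proof.
move=> cE; rewrite /linext (big_fset_incl _ cE) // => x _ xc.
by rewrite mcoeff_outdom // scale0r.
Qed.

Lemma linext_is_linear : linear linext.
Proof.
move=> a c d; set E := (msupp c `|` msupp d)%fset.
have Ec : (msupp c `<=` E)%fset by exact: fsubsetUl.
have Ed : (msupp d `<=` E)%fset by exact: fsubsetUr.
have Ecd : (msupp (a *: c + d) `<=` E)%fset.
  apply/fsubsetP => x; apply: contraTT => xE.
  rewrite -mcoeff_eq0 mcoeffD mcoeffZ !mcoeff_outdom ?mulr0 ?addr0 //.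
    by apply: contra xE => /(fsubsetP Ed).
  by apply: contra xE => /(fsubsetP Ec).
rewrite (linextEw Ecd) (linextEw Ec) (linextEw Ed) scaler_sumr -big_split.
by apply: eq_bigr => x _; rewrite mcoeffD mcoeffZ scalerDl scalerA.
Qed.

HB.instance Definition _ :=
  GRing.isLinear.Build G {malg G[T]} M *:%R linext linext_is_linear.

Lemma linextU x : linext << x >> = f x.
Proof.
by rewrite (linextEw msuppU_le) big_seq_fset1 mcoeffUU scale1r.
Qed.

End LinearExtension.

Lemma linextP (G : comNzRingType) (T : choiceType) (M : lmodType G)
    (f g : {linear {malg G[T]} -> M}) :
  (forall x, f << x >> = g << x >>) -> f =1 g.
Proof.
move=> fg c; rewrite (monalgEw (fsubset_refl (msupp c))) !linear_sum.
apply: eq_bigr => x _.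
have -> : << c@_x *g x >> = c@_x *: << x >>.
  by apply/malgP => y; rewrite mcoeffZ !mcoeffU mulrnAr mulr1.
by rewrite !linearZ /= fg.
Qed.

(* ------------------------------------------------------------------------ *)

Section QuotientModule.
Variables (G : comNzRingType) (M : lmodType G) (Q : set M).

Inductive spanned : M -> Prop :=
| spanned_gen x : Q x -> spanned x
| spanned0 : spanned 0
| spannedP a x y : spanned x -> spanned y -> spanned (a *: x + y).

Definition lspan : {pred M} := fun x => `[< spanned x >].

Fact lspan_submod_closed : submod_closed lspan.
Proof.
split=> [|a x y]; rewrite !unfold_in; first by apply/asboolP; exact: spanned0.
by move=> /asboolP sx /asboolP sy; apply/asboolP; exact: spannedP.
Qed.
HB.instance Definition _ := GRing.isSubmodClosed.Build G M lspan
  lspan_submod_closed.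
HB.instance Definition _ := GRing.isZmodClosed.Build M lspan
  (lspan_submod_closed : zmod_closed lspan).

(* The quotient of [M] by the submodule generated by [Q]. *)
Definition lquot := Quotient.quot lspan.
HB.instance Definition _ := GRing.Zmodule.on lquot.

Definition lpi (x : M) : lquot := (\pi_(Quotient.quot lspan) x)%qT.

Lemma lpi_eq x y : (lpi x = lpi y) <-> (x - y \in lspan).
Proof.
rewrite (Quotient.idealrBE lspan x y); split => [h|/eqP//]; exact/eqP.
Qed.

Definition lquot_scale (a : G) (q : lquot) : lquot := lpi (a *: repr q).

Lemma lpi_reprK (q : lquot) : lpi (repr q) = q.
Proof. exact: reprK. Qed.

Lemma lquot_scale_pi a x : lquot_scale a (lpi x) = lpi (a *: x).
Proof.
rewrite /lquot_scale; apply/lpi_eq; rewrite -scalerBr rpredZ //.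
by apply/lpi_eq; exact: lpi_reprK.
Qed.

Lemma lpiD x y : lpi (x + y) = lpi x + lpi y.
Proof. by rewrite /lpi !piE. Qed.

Fact lquot_scaleA a b q :
  lquot_scale a (lquot_scale b q) = lquot_scale (a * b) q.
Proof. by rewrite -[q]lpi_reprK !lquot_scale_pi scalerA. Qed.
Fact lquot_scale1 : left_id 1 lquot_scale.
Proof. by move=> q; rewrite -[q]lpi_reprK lquot_scale_pi scale1r. Qed.
Fact lquot_scaleDr : right_distributive lquot_scale +%R.
Proof.
move=> a p q; rewrite -[p]lpi_reprK -[q]lpi_reprK.
by rewrite -lpiD !lquot_scale_pi scalerDr lpiD.
Qed.
Fact lquot_scaleDl q : {morph lquot_scale^~ q : a b / a + b}.
Proof.
move=> a b; rewrite -[q]lpi_reprK.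
by rewrite !lquot_scale_pi scalerDl lpiD.
Qed.

HB.instance Definition _ := GRing.Zmodule_isLmodule.Build G lquot
  lquot_scaleA lquot_scale1 lquot_scaleDr lquot_scaleDl.

Lemma lpi_is_linear : linear lpi.
Proof. by move=> a x y; rewrite lpiD -lquot_scale_pi. Qed.
HB.instance Definition _ :=
  GRing.isLinear.Build G M lquot *:%R lpi lpi_is_linear.

Lemma lpi_rel x : Q x -> lpi x = 0.
Proof.
move=> Qx; rewrite -(linear0 lpi); apply/lpi_eq; rewrite subr0.
by apply/asboolP; exact: spanned_gen.
Qed.

Variables (N : lmodType G) (f : {linear M -> N}).

Definition qlift of (forall x, Q x -> f x = 0) :=
  fun q : lquot => f (repr q).

Variable Qf : forall x, Q x -> f x = 0.

Lemma qlift_pi x : qlift Qf (lpi x) = f x.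
Proof.
apply/eqP; rewrite -subr_eq0 -linearB; apply/eqP.
have : repr (lpi x) - x \in lspan by apply/lpi_eq; exact: lpi_reprK.
rewrite unfold_in => /asboolP; elim=> [y /Qf//||a y z _ fy _ fz].
  exact: linear0.
by rewrite linearP fy fz scaler0 addr0.
Qed.

Lemma qlift_is_linear : linear (qlift Qf).
Proof.
move=> a p q; rewrite -[p]lpi_reprK -[q]lpi_reprK.
by rewrite -linearP !qlift_pi linearP.
Qed.
HB.instance Definition _ :=
  GRing.isLinear.Build G lquot N *:%R (qlift Qf) qlift_is_linear.

End QuotientModule.

(* ------------------------------------------------------------------------ *)

(* Nonnegatively graded and augmented over [G]; the augmentation may fail to be
   surjective. *)
Record chainComplex (G : comNzRingType) := ChainComplex {
  chain :> nat -> lmodType G;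
  bnd : forall k, {linear chain k.+1 -> chain k};
  aug : {linear chain 0%N -> G^o};
  bnd_bnd : forall k (c : chain k.+2), bnd k (bnd k.+1 c) = 0;
  aug_bnd : forall c : chain 1%N, aug (bnd 0%N c) = 0
}.
Arguments bnd {G} C k : rename.
Arguments aug {G} C : rename.

Record chainMorphism (G : comNzRingType) (C D : chainComplex G) :=
  ChainMorphism {
    cmor :> forall k, {linear C k -> D k};
    cmor_bnd : forall k (c : C k.+1), bnd D k (cmor k.+1 c) = cmor k (bnd C k c);
    cmor_aug : forall c : C 0%N, aug D (cmor 0%N c) = aug C c
  }.

Section CompMorphism.
Variables (G : comNzRingType) (B C D : chainComplex G).
Variables (g : chainMorphism C D) (f : chainMorphism B C).

Definition cmor_comp : chainMorphism B D.
Proof.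
exists (fun k => (g k \o f k : {linear B k -> D k})).
- by move=> k c; rewrite /= !cmor_bnd.
- by move=> c; rewrite /= !cmor_aug.
Defined.

End CompMorphism.

(* ------------------------------------------------------------------------ *)

Section AlternatingSum.
Variable G : comNzRingType.

(* Boundary and augmentation on the free modules over the sets of simplices of
   a semisimplicial set with face operators [d]. *)
Variables (T : nat -> choiceType) (d : forall k, 'I_k.+2 -> T k.+1 -> T k).

Definition alt_bnd k : {malg G[T k.+1]} -> {malg G[T k]} :=
  linext (fun x => \sum_(i < k.+2) (-1) ^+ i *: << d i x >>).
HB.instance Definition _ k := GRing.Linear.on (@alt_bnd k).

Definition alt_aug : {malg G[T 0%N]} -> G^o := linext (fun _ => 1 : G^o).
HB.instance Definition _ := GRing.Linear.on alt_aug.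

Lemma alt_bndU k (x : T k.+1) :
  alt_bnd << x >> = \sum_(i < k.+2) (-1) ^+ i *: << d i x >>.
Proof. exact: linextU. Qed.

Lemma alt_augU (x : T 0%N) : alt_aug << x >> = 1.
Proof. exact: linextU. Qed.

Hypothesis dd : forall k (i j : 'I_k.+2) (x : T k.+2), (i <= j)%N ->
  d i (d (lift ord0 j) x) = d j (d (widen_ord (leqnSn _) i) x).

Lemma alt_bnd_bnd k (c : {malg G[T k.+2]}) : alt_bnd (alt_bnd c) = 0.
Proof.
pose f := (@alt_bnd k \o @alt_bnd k.+1 : {linear _ -> _}).
rewrite -[LHS]/(f c) -[RHS]/((\0 : {linear _ -> _}) c).
apply: linextP => x; rewrite /= alt_bndU linear_sum /=.
under eq_bigr => j _.
  rewrite linearZ /= alt_bndU scaler_sumr.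
  under eq_bigr => i _ do rewrite scalerA -exprD.
  over.
rewrite exchange_big /=.
under eq_bigr => i _ do rewrite (bigID (fun j : 'I_ _ => (j <= i)%N)) /=.
rewrite big_split /=; apply/eqP; rewrite addr_eq0; apply/eqP.
transitivity (\sum_(i < k.+2) \sum_(j < k.+2 | (j <= i)%N)
    (-1) ^+ (j + i) *: << d i (d (widen_ord (leqnSn _) j) x) >> : {malg G[T k]}).
  apply: eq_bigr => i _; rewrite big_mkcond big_ord_recr /= leqNgt ltn_ord addr0.
  by rewrite -big_mkcond.
rewrite (exchange_big_dep predT) //= -sumrN; apply: eq_bigr => i _.
rewrite [in RHS]big_mkcond big_ord_recl /= add0r -sumrN.
rewrite [LHS]big_mkcond /=; apply: eq_bigr => j _.
rewrite /bump /= add1n -ltnNge ltnS; case: ifP => ij; last by rewrite oppr0.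
rewrite addSn exprS mulN1r scaleNr opprK addnC; congr (_ *: << _ >>).
by rewrite -dd.
Qed.

Lemma alt_aug_bnd (c : {malg G[T 1%N]}) : alt_aug (alt_bnd c) = 0.
Proof.
pose f := (alt_aug \o @alt_bnd 0%N : {linear _ -> _}).
rewrite -[LHS]/(f c) -[RHS]/((\0 : {linear _ -> G^o}) c).
apply: linextP => x; rewrite /= alt_bndU linear_sum /= !big_ord_recl big_ord0.
by rewrite !linearZ /= !alt_augU expr0 scale1r expr1 scaleN1r addr0 subrr.
Qed.

End AlternatingSum.
Arguments alt_bnd G {T} d {k} : rename.
Arguments alt_aug G T : clear implicits.

(* ------------------------------------------------------------------------ *)

Lemma lift_lift k (i j : 'I_k.+2) (a : 'I_k.+1) : (i <= j)%N ->
  lift (lift ord0 j) (lift i a) = lift (widen_ord (leqnSn _) i) (lift j a).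
Proof.
move=> ij; apply: val_inj; rewrite /= /bump /= add1n.
by case: (leqP i a); case: (leqP j a); lia.
Qed.

Section StandardSimplex.
Variable R : realType.

Lemma realD_continuous : continuous (fun z : R * R => z.1 + z.2).
Proof.
move=> [x y] A /nbhs_ballP[e /= e0 eA].
exists (ball x (e / 2), ball y (e / 2)).
  by split => /=; apply: nbhsx_ballx; rewrite divr_gt0 // ltr0n.
move=> [a b] [/= xa yb]; apply: eA; rewrite /ball /= in xa yb *.
rewrite opprD addrACA (le_lt_trans (ler_normD _ _))// [e]splitr.
exact: ltrD.
Qed.

Lemma mx_coord_continuous m n i j : continuous (fun M : 'M[R]_(m, n) => M i j).
Proof.
move=> M A MA; exists (fun a b => [set x | (a, b) = (i, j) -> A x]).
  move=> a b; case: (pselect ((a, b) = (i, j))) => [[-> ->]|abij].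
    by apply: filterS MA => x Ax _.
  by apply: filterS filterT => x _ abij'; case: abij.
by move=> N /(_ i j) /=; exact.
Qed.

Definition std_simplex k : set 'rV[R]_k.+1 :=
  [set t | (forall i, 0 <= t ord0 i) /\ \sum_i t ord0 i = 1].
Arguments std_simplex : clear implicits.

Definition Simplex k := set_type (std_simplex k).
HB.instance Definition _ k := Topological.on (Simplex k).

Section SimplexMap.
Variables (j k : nat) (h : 'I_j.+1 -> 'I_k.+1).

(* The affine map sending the vertex [e_a] to the vertex [e_(h a)]. *)
Definition simplex_mx (t : 'rV[R]_j.+1) : 'rV[R]_k.+1 :=
  \row_i \sum_(a | h a == i) t ord0 a.

Lemma simplex_mx_std t : std_simplex j t -> std_simplex k (simplex_mx t).
Proof.
move=> [t0 t1]; split=> [i|]; first by rewrite mxE sumr_ge0.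
rewrite -t1 (partition_big h predT) //=.
by apply: eq_bigr => i _; rewrite mxE.
Qed.

Definition simplex_map (t : Simplex j) : Simplex k :=
  SigSub (mem_set (simplex_mx_std (set_valP t))).

Lemma simplex_map_continuous : continuous simplex_map.
Proof.
apply/continuousP => _ [A oA <-]; rewrite -comp_preimage.
pose f : Simplex j -> 'rV[R]_k.+1 := simplex_mx \o set_val.
suff f_cont : continuous f by have /continuousP := f_cont; apply.
move=> t B [P PB sPB].
suff : nbhs t [set s | forall a b, P a b (f s a b)].
  by apply: filterS => s; exact: sPB.
apply: (@filter_forall _ _ (fun a => [set s | forall b, P a b (f s a b)])
  _ (nbhs_filter t)) => a.
apply: (@filter_forall _ _ (fun b => [set s | P a b (f s a b)]) _ (nbhs_filter t)) => b.
suff fb_cont : continuous (fun s => f s a b) by exact: fb_cont (PB a b).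
have -> : (fun s => f s a b) = fun s => \sum_(c | h c == b) set_val s ord0 c.
  by apply/funext => s; rewrite mxE.
apply: continuous_big; first exact: realD_continuous.
move=> c _ s.
apply: (@continuous_comp _ _ _ set_val (fun M : 'rV[R]_j.+1 => M ord0 c)).
  exact: initial_continuous.
exact: mx_coord_continuous.
Qed.

HB.instance Definition _ :=
  isContinuous.Build (Simplex j) (Simplex k) simplex_map simplex_map_continuous.

End SimplexMap.

Lemma simplex_map_comp i j k (h : 'I_j.+1 -> 'I_k.+1) (g : 'I_i.+1 -> 'I_j.+1) t :
  simplex_map h (simplex_map g t) = simplex_map (h \o g) t.
Proof.
apply: val_inj; apply/rowP => b; rewrite !mxE /=.
rewrite (partition_big g (fun a => h a == b)) //=.
apply: eq_bigr => a /eqP hab; rewrite mxE; apply: eq_bigl => c.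
by case: eqVneq => [->|]; rewrite ?andbF // hab eqxx.
Qed.

End StandardSimplex.
Arguments Simplex R k : clear implicits.

Section SingularComplex.
Variables (R : realType) (G : comNzRingType).

Definition singularSimplex (X : topologicalType) k :=
  continuousType (Simplex R k) X.
HB.instance Definition _ X k := Choice.on (singularSimplex X k).

Section Complex.
Variable X : topologicalType.

Definition sing_pull j k (h : 'I_j.+1 -> 'I_k.+1) (s : singularSimplex X k) :
  singularSimplex X j := s \o simplex_map h.

Definition sing_face k (i : 'I_k.+2) : singularSimplex X k.+1 -> singularSimplex X k
  := sing_pull (lift i).

Lemma sing_face_face k (i j : 'I_k.+2) (s : singularSimplex X k.+2) : (i <= j)%N ->
  sing_face i (sing_face (lift ord0 j) s)
  = sing_face j (sing_face (widen_ord (leqnSn _) i) s).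
Proof.
move=> ij; apply/continuousEP => t /=; rewrite !simplex_map_comp.
by congr (s (simplex_map _ t)); apply/funext => a /=; exact: lift_lift.
Qed.

Definition singular : chainComplex G :=
  {| chain := fun k => {malg G[singularSimplex X k]};
     bnd := fun k => alt_bnd G sing_face;
     aug := alt_aug G (singularSimplex X);
     bnd_bnd := alt_bnd_bnd sing_face_face;
     aug_bnd := alt_aug_bnd _ |}.

End Complex.
End SingularComplex.

(* ------------------------------------------------------------------------ *)

Section SingularMap.
Variables (R : realType) (G : comNzRingType) (Y X : topologicalType).
Variable f : continuousType Y X.

Definition sing_push k (s : singularSimplex R Y k) : singularSimplex R X k := f \o s.

Definition singular_map_def k : singular R G Y k -> singular R G X k :=
  linext (fun s => << sing_push s >> : {malg G[singularSimplex R X k]}).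
HB.instance Definition _ k := GRing.Linear.on (@singular_map_def k).

Fact singular_map_bnd k (c : singular R G Y k.+1) :
  bnd (singular R G X) k (singular_map_def c)
  = singular_map_def (bnd (singular R G Y) k c).
Proof.
pose l := (bnd (singular R G X) k \o @singular_map_def k.+1 : {linear _ -> _}).
pose r := (@singular_map_def k \o bnd (singular R G Y) k : {linear _ -> _}).
rewrite -[LHS]/(l c) -[RHS]/(r c); apply: linextP => s /=.
rewrite /singular_map_def linextU !alt_bndU linear_sum.
apply: eq_bigr => i _; rewrite linearZ /= linextU; congr (_ *: << _ >>).
exact/continuousEP.
Qed.

Fact singular_map_aug (c : singular R G Y 0%N) :
  aug (singular R G X) (singular_map_def c) = aug (singular R G Y) c.
Proof.
pose l := (aug (singular R G X) \o @singular_map_def 0%N : {linear _ -> _}).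
rewrite -[LHS]/(l c); apply: linextP => s /=.
by rewrite /singular_map_def linextU !alt_augU.
Qed.

Definition singular_map : chainMorphism (singular R G Y) (singular R G X) :=
  {| cmor := fun k => @singular_map_def k;
     cmor_bnd := singular_map_bnd;
     cmor_aug := singular_map_aug |}.

End SingularMap.

HB.instance Definition _ (Y : topologicalType) (A : set Y) :=
  isContinuous.Build (set_type A) Y set_val (@initial_continuous _ _ _).

(* [S(A;G) -> S(Y;G)] for a subspace [A] of [Y]. *)
Definition singular_incl (R : realType) (G : comNzRingType)
    (Y : topologicalType) (A : set Y) :
    chainMorphism (singular R G (set_type A)) (singular R G Y) :=
  singular_map R G (set_val : continuousType (set_type A) Y).

(* ------------------------------------------------------------------------ *)

Record simplicialComplex (V : choiceType) := SimplicialComplex {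
  simplices :> set {fset V};
  simplices_neq0 : forall s, simplices s -> s != fset0;
  simplices_sub : forall s t, simplices s -> (t `<=` s)%fset -> t != fset0 ->
    simplices t
}.

Definition vertices (V : choiceType) (K : simplicialComplex V) : set V :=
  [set v | simplices K [fset v]%fset].

Lemma perm_lift_perm k (p : 'S_k.+1) (i : 'I_k.+1) :
  exists q : 'S_k, p = lift_perm i (p i) q.
Proof.
pose f a := odflt a (unlift (p i) (p (lift i a))).
have fE a : lift (p i) (f a) = p (lift i a).
  rewrite /f; case: unliftP => [b ->//|/perm_inj/eqP].
  by rewrite eq_sym (negbTE (neq_lift _ _)).
have f_inj : injective f.
  move=> a b fab; apply: (@lift_inj _ i); apply: (@perm_inj _ p).
  by rewrite -!fE fab.
exists (perm f_inj); apply/permP => x; case: (unliftP i x) => [a ->|->].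
  by rewrite lift_perm_lift permE fE.
by rewrite lift_perm_id.
Qed.

Section OrientedComplex.
Variables (G : comNzRingType) (V : choiceType).

Definition vset k (s : {ffun 'I_k.+1 -> V}) : {fset V} :=
  [fset s i | i in 'I_k.+1]%fset.

Section Complex.
Variable K : simplicialComplex V.

(* The [k]-simplices of [K] endowed with a total ordering of their vertices. *)
Record orderedSimplex k := OrderedSimplex {
  overtex :> {ffun 'I_k.+1 -> V};
  overtexP : injectiveb overtex && `[< simplices K (vset overtex) >]
}.
HB.instance Definition _ k := [isSub for @overtex k].
HB.instance Definition _ k := gen_eqMixin (orderedSimplex k).
HB.instance Definition _ k := gen_choiceMixin (orderedSimplex k).

Fact ord_pull_subproof j k (h : 'I_j.+1 -> 'I_k.+1) (s : orderedSimplex k) :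
  injective h -> let t := [ffun a => s (h a)] in
  injectiveb t && `[< simplices K (vset t) >].
Proof.
case: s => s /= /andP[/injectiveP s_inj /asboolP Ks] h_inj.
apply/andP; split.
  by apply/injectiveP => a b; rewrite !ffunE => /s_inj/h_inj.
apply/asboolP/(simplices_sub Ks).
  apply/fsubsetP => _ /imfsetP[/= a _ ->]; rewrite ffunE.
  by apply/imfsetP; exists (h a).
by apply/fset0Pn; exists (s (h ord0)); apply/imfsetP; exists ord0; rewrite ?ffunE.
Qed.

Definition ord_pull j k (h : 'I_j.+1 -> 'I_k.+1) (h_inj : injective h)
    (s : orderedSimplex k) : orderedSimplex j :=
  OrderedSimplex (ord_pull_subproof s h_inj).

Definition ord_face k (i : 'I_k.+2) : orderedSimplex k.+1 -> orderedSimplex k :=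
  ord_pull (@lift_inj _ i).

Definition ord_perm k (p : 'S_k.+1) : orderedSimplex k -> orderedSimplex k :=
  ord_pull (@perm_inj _ p).

Lemma ord_face_face k (i j : 'I_k.+2) (s : orderedSimplex k.+2) : (i <= j)%N ->
  ord_face i (ord_face (lift ord0 j) s)
  = ord_face j (ord_face (widen_ord (leqnSn _) i) s).
Proof.
by move=> ij; apply/val_inj/ffunP => a; rewrite !ffunE lift_lift.
Qed.

(* Oriented chains: the orderings of a simplex generate, with the relation that
   a permutation of the vertices multiplies by its signature. *)
Definition orient_rel k : set {malg G[orderedSimplex k]} :=
  [set c | exists (p : 'S_k.+1) (s : orderedSimplex k),
             c = << ord_perm p s >> - (-1) ^+ p *: << s >>].

Local Notation orientedChain k := (lquot (@orient_rel k)).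

Definition oriented_bnd_pre k : {malg G[orderedSimplex k.+1]} -> orientedChain k :=
  @lpi _ _ (@orient_rel k) \o alt_bnd G ord_face.
HB.instance Definition _ k := GRing.Linear.on (@oriented_bnd_pre k).

Fact lpi_ord_perm k (p : 'S_k.+1) (s : orderedSimplex k) :
  lpi (@orient_rel k) << ord_perm p s >>
  = (-1) ^+ p *: lpi (@orient_rel k) << s >>.
Proof.
apply/eqP; rewrite -subr_eq0 -linearZ -linearB; apply/eqP/lpi_rel.
by exists p, s.
Qed.

Fact oriented_bnd_rel k c : @orient_rel k.+1 c -> oriented_bnd_pre c = 0.
Proof.
move=> [p [s ->]]; apply/eqP; rewrite linearB subr_eq0 linearZ; apply/eqP.
rewrite /=; set piM := lpi (@orient_rel k).
rewrite -[LHS]/(piM (alt_bnd G ord_face << ord_perm p s >>)).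
rewrite -[X in _ = _ *: X]/(piM (alt_bnd G ord_face << s >>)).
rewrite !alt_bndU /piM 2!linear_sum scaler_sumr.
rewrite [RHS](reindex_inj (@perm_inj _ p)) /=; apply: eq_bigr => i _.
have [q pq] := perm_lift_perm p i.
have -> : ord_face i (ord_perm p s) = ord_perm q (ord_face (p i) s).
  by apply/val_inj/ffunP => a; rewrite !ffunE {1}pq lift_perm_lift.
rewrite !linearZ /= lpi_ord_perm !scalerA; congr (_ *: _).
have -> : (-1) ^+ p = (-1) ^+ i * (-1) ^+ (p i) * (-1) ^+ q :> G.
  by rewrite {1}pq odd_lift_perm !signr_addb !signr_odd.
by rewrite -[in RHS]mulrA mulrCA; congr (_ * _); rewrite mulrA -expr2 sqrr_sign mul1r.
Qed.

Definition oriented_bnd k : orientedChain k.+1 -> orientedChain k :=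
  qlift (@oriented_bnd_rel k).
HB.instance Definition _ k := GRing.Linear.on (@oriented_bnd k).

Lemma oriented_bndE k (c : {malg G[orderedSimplex k.+1]}) :
  oriented_bnd (lpi (@orient_rel k.+1) c)
  = lpi (@orient_rel k) (alt_bnd G ord_face c).
Proof. exact: qlift_pi. Qed.

Fact oriented_aug_rel c :
  @orient_rel 0%N c -> alt_aug G orderedSimplex c = 0.
Proof.
move=> [p [s ->]]; rewrite linearB linearZ /= !alt_augU.
have -> : p = 1%g by apply/permP => i; rewrite [LHS]ord1 [RHS]ord1.
by rewrite odd_perm1 expr0 scale1r subrr.
Qed.

Definition oriented_aug : orientedChain 0%N -> G^o := qlift oriented_aug_rel.
HB.instance Definition _ := GRing.Linear.on oriented_aug.

Lemma oriented_augE (c : {malg G[orderedSimplex 0%N]}) :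
  oriented_aug (lpi (@orient_rel 0%N) c) = alt_aug G orderedSimplex c.
Proof. exact: qlift_pi. Qed.

Fact oriented_bnd_bnd k (c : orientedChain k.+2) :
  oriented_bnd (oriented_bnd c) = 0.
Proof.
rewrite -[c]lpi_reprK !oriented_bndE.
by rewrite (alt_bnd_bnd ord_face_face) linear0.
Qed.

Fact oriented_aug_bnd (c : orientedChain 1%N) :
  oriented_aug (oriented_bnd c) = 0.
Proof.
by rewrite -[c]lpi_reprK oriented_bndE oriented_augE alt_aug_bnd.
Qed.

Definition oriented : chainComplex G :=
  {| chain := fun k => orientedChain k;
     bnd := fun k => @oriented_bnd k;
     aug := oriented_aug;
     bnd_bnd := oriented_bnd_bnd;
     aug_bnd := oriented_aug_bnd |}.

(* The oriented simplex determined by an ordering of its vertices. *)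
Definition ochain k (s : orderedSimplex k) : oriented k :=
  lpi (@orient_rel k) << s >>.

Lemma bnd_ochain k (s : orderedSimplex k.+1) :
  bnd oriented k (ochain s) = \sum_(i < k.+2) (-1) ^+ i *: ochain (ord_face i s).
Proof.
rewrite [LHS]oriented_bndE alt_bndU linear_sum; apply: eq_bigr => i _.
exact: linearZ.
Qed.

Lemma aug_ochain (s : orderedSimplex 0%N) : aug oriented (ochain s) = 1.
Proof. by rewrite [LHS]oriented_augE alt_augU. Qed.

Lemma ochain_perm k (p : 'S_k.+1) (s : orderedSimplex k) :
  ochain (ord_perm p s) = (-1) ^+ p *: ochain s.
Proof. exact: lpi_ord_perm. Qed.

Lemma oriented_linP k (M : lmodType G) (f g : {linear oriented k -> M}) :
  (forall s, f (ochain s) = g (ochain s)) -> f =1 g.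
Proof.
move=> fg c; rewrite -[c]lpi_reprK.
pose f' := (f \o lpi (@orient_rel k) : {linear _ -> _}).
pose g' := (g \o lpi (@orient_rel k) : {linear _ -> _}).
by rewrite -[LHS]/(f' _) -[RHS]/(g' _); exact: linextP.
Qed.

End Complex.

(* [C(L;G) -> C(K;G)] for a subcomplex [L] of [K]. *)
Section Inclusion.
Variables (L K : simplicialComplex V) (LK : L `<=` K).

Fact ord_incl_subproof k (s : orderedSimplex L k) :
  injectiveb s && `[< simplices K (vset s) >].
Proof.
by case: s => s /= /andP[-> /asboolP Ls]; apply/asboolP; exact: LK.
Qed.

Definition ord_incl k (s : orderedSimplex L k) : orderedSimplex K k :=
  OrderedSimplex (ord_incl_subproof s).

Definition oriented_incl_pre k : {malg G[orderedSimplex L k]} -> oriented K k :=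
  linext (fun s => ochain (ord_incl s)).
HB.instance Definition _ k := GRing.Linear.on (@oriented_incl_pre k).

Fact oriented_incl_rel k c : @orient_rel L k c -> oriented_incl_pre c = 0.
Proof.
move=> [p [s ->]]; apply/eqP; rewrite linearB subr_eq0 linearZ; apply/eqP.
rewrite /= /oriented_incl_pre !linextU.
have -> : ord_incl (ord_perm p s) = ord_perm p (ord_incl s) by exact/val_inj.
exact: lpi_ord_perm.
Qed.

Definition oriented_incl_def k : oriented L k -> oriented K k :=
  qlift (@oriented_incl_rel k).
HB.instance Definition _ k := GRing.Linear.on (@oriented_incl_def k).

Lemma oriented_incl_def_ochain k (s : orderedSimplex L k) :
  oriented_incl_def (ochain s) = ochain (ord_incl s).
Proof.
rewrite /oriented_incl_def /ochain qlift_pi.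
exact: (linextU (fun s => ochain (ord_incl s))).
Qed.

Fact oriented_incl_bnd k (c : oriented L k.+1) :
  bnd (oriented K) k (oriented_incl_def c)
  = oriented_incl_def (bnd (oriented L) k c).
Proof.
pose l := (bnd (oriented K) k \o @oriented_incl_def k.+1 : {linear _ -> _}).
pose r := (@oriented_incl_def k \o bnd (oriented L) k : {linear _ -> _}).
rewrite -[LHS]/(l c) -[RHS]/(r c); apply: oriented_linP => s.
rewrite /l /r /= oriented_incl_def_ochain !bnd_ochain linear_sum.
apply: eq_bigr => i _; rewrite linearZ /= oriented_incl_def_ochain.
by congr (_ *: ochain _); exact/val_inj.
Qed.

Fact oriented_incl_aug (c : oriented L 0%N) :
  aug (oriented K) (oriented_incl_def c) = aug (oriented L) c.
Proof.
pose l := (aug (oriented K) \o @oriented_incl_def 0%N : {linear _ -> _}).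
rewrite -[LHS]/(l c); apply: oriented_linP => s.
by rewrite /l /= oriented_incl_def_ochain !aug_ochain.
Qed.

Definition oriented_incl : chainMorphism (oriented L) (oriented K) :=
  {| cmor := fun k => @oriented_incl_def k;
     cmor_bnd := oriented_incl_bnd;
     cmor_aug := oriented_incl_aug |}.

End Inclusion.
End OrientedComplex.
Arguments ochain G {V K k} s.

(* ------------------------------------------------------------------------ *)

Section Carriers.
Variables (R : realType) (G : comNzRingType).

Definition schain (X : topologicalType) k (s : singularSimplex R X k) :
  singular R G X k := << s >>.

Definition carrier (X : topologicalType) k (c : singular R G X k) : set X :=
  \bigcup_(s in [set` msupp (c : {malg G[singularSimplex R X k]})]) range s.

(* [t] is a face of [s], with its domain identified with a standard simplex by the
   increasing map on vertices. *)
Definition is_face (X : topologicalType) j k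
    (t : singularSimplex R X j) (s : singularSimplex R X k) : Prop :=
  exists2 h : 'I_j.+1 -> 'I_k.+1,
    (forall a b : 'I_j.+1, (a < b)%N -> (h a < h b)%N) & t = sing_pull h s.

Variables Y X : topologicalType.
Implicit Types phi psi : chainMorphism (singular R G Y) (singular R G X).

Definition correct phi : Prop :=
  forall v : singularSimplex R Y 0, exists x : singularSimplex R X 0,
    phi 0%N (schain v) = schain x.

Definition cover_close (U : set (set X)) phi psi : Prop :=
  forall k (s : singularSimplex R Y k), exists2 B, U B &
    forall j (t : singularSimplex R Y j), is_face t s ->
      carrier (phi j (schain t)) `|` carrier (psi j (schain t)) `<=` B.

Record chainHomotopy phi psi := ChainHomotopy {
  hmap :> forall k, {linear singular R G Y k -> singular R G X k.+1};
  hmap0 : forall s : singularSimplex R Y 0,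
    bnd (singular R G X) 0 (hmap 0%N (schain s))
    = phi 0%N (schain s) - psi 0%N (schain s);
  hmapS : forall k (s : singularSimplex R Y k.+1),
    bnd (singular R G X) k.+1 (hmap k.+1 (schain s))
    = phi k.+1 (schain s) - psi k.+1 (schain s)
      - hmap k (bnd (singular R G Y) k (schain s))
}.

Definition cover_small (U : set (set X)) phi psi
    (D : chainHomotopy phi psi) : Prop :=
  forall k (s : singularSimplex R Y k), exists2 B, U B &
    forall j (t : singularSimplex R Y j) (v : singularSimplex R Y 0),
      is_face t s -> is_face v s ->
      carrier (D j (schain t)) `|` carrier (phi 0%N (schain v))
        `|` carrier (psi 0%N (schain v)) `<=` B.

End Carriers.
Arguments schain {R} G {X k} s.

(* ------------------------------------------------------------------------ *)

Section AlgebraicRealization.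
Variables (R : realType) (G : comNzRingType) (X : topologicalType).
Variable V : choiceType.

Definition correct_oriented (L : simplicialComplex V)
    (phi : chainMorphism (oriented G L) (singular R G X)) : Prop :=
  forall v : orderedSimplex L 0, exists x : singularSimplex R X 0,
    phi 0%N (ochain G v) = schain G x.

Definition partial_realization (U : set (set X)) (K L : simplicialComplex V)
    (phi : chainMorphism (oriented G L) (singular R G X)) : Prop :=
  [/\ L `<=` K, vertices K `<=` vertices L &
      forall s, simplices K s -> exists2 B, U B &
        forall j (t : orderedSimplex L j), (vset t `<=` s)%fset ->
          carrier (phi j (ochain G t)) `<=` B].

Definition full_realization (U : set (set X)) (K : simplicialComplex V)
    (phi : chainMorphism (oriented G K) (singular R G X)) : Prop :=
  partial_realization U K phi.

Definition extends (K L : simplicialComplex V) (LK : L `<=` K)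
    (psi : chainMorphism (oriented G K) (singular R G X))
    (phi : chainMorphism (oriented G L) (singular R G X)) : Prop :=
  forall k (c : oriented G L k), psi k (oriented_incl G LK k c) = phi k c.

End AlgebraicRealization.

Definition algebraic_ANR (R : realType) (G : comNzRingType) (X : metricType R) :
    Prop :=
  forall U : set (set X), open_cover U ->
  exists V : set (set X), [/\ open_cover V, refines V U &
    forall (T : choiceType) (K L : simplicialComplex T) (LK : L `<=` K)
      (phi : chainMorphism (oriented G L) (singular R G X)),
    partial_realization V K phi -> correct_oriented phi ->
    exists psi : chainMorphism (oriented G K) (singular R G X),
      extends LK psi phi /\ full_realization U psi].

(* Main.v *)
Require Import Defs.
From HB Require Import structures.
From mathcomp Require Import all_boot all_order all_algebra fingroup perm.
From mathcomp Require Import finmap.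
From mathcomp Require Import all_classical reals topology.
From mathcomp Require Import monalg zify lra.

Set Implicit Arguments.
Unset Strict Implicit.
Unset Printing Implicit Defensive.

Import Order.TTheory GRing.Theory Num.Theory.

Local Open Scope classical_set_scope.
Local Open Scope ring_scope.

(** The singular simplices of [Y] form a semisimplicial set, which is turned into a
    simplicial complex by taking its second barycentric subdivision: faces of a simplex
    may coincide, but once they are replaced by flags of faces a vertex of a simplex of
    the subdivision determines its position. The subdivision chain [alpha s] of a
    singular simplex [s] is carried by the flags of faces of [s], and the last-vertex map
    sends it back to [s]. On the prism over the subdivision, let [L] consist of the two
    ends and of the part lying over [A]. Composing the last-vertex map (and, over [A], the
    Alexander-Whitney map of the prism) with [phi], [psi] and [D] gives a partial
    realization on [L] of the complex [K] of all finite sets of vertices lying over the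
    faces of one singular simplex. If [Psi] extends it to [K], then
    [Psi (prism (alpha s))] is the required homotopy. The carriers of [D] over several
    faces of [s] in [A] are put into one member of the cover by a star refinement, which
    exists since [X] is metric. *)

(** The homotopy has to agree with [D] exactly, so the last-vertex map must undo the subdivision on
    the nose. As [phi], [psi] and [D] need not vanish on degenerate singular simplices, a sequence
    of vertices with a repetition is given the value 0 before these maps are applied; the collapsed
    simplices then disappear. After a single subdivision, a vertex would be a singular simplex that
    may sit in several places of the next one. In the second, the largest vertex of a simplex is a
    flag, and the members of a flag are told apart by their cardinality. The complex [K] is much
    larger than the prism for the sake of smallness: a realization provides one member of the cover
    for each simplex of the complex, while one member has to serve all faces of a singular simplex
    [s], so all vertices over the faces of [s] must form one simplex. Oriented chains have no
    preferred orderings; the size of a flag plus its level orders the vertices of each simplex of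
    [L], consistently on faces. *)

Section Support.
Variable G : comNzRingType.

(** Many identities below hold only on generators of a special shape, such as flags or ranked
    sequences; this predicate carries that shape through linear maps. *)
Definition supp_in (T : choiceType) (Q : T -> Prop) (c : {malg G[T]}) : Prop :=
  forall x, x \in msupp c -> Q x.

Section Closure.
Variables (T : choiceType) (Q : T -> Prop).

Lemma supp_in0 : supp_in Q 0.
Proof. by move=> x; rewrite msupp0 inE. Qed.

Lemma supp_inD c d : supp_in Q c -> supp_in Q d -> supp_in Q (c + d).
Proof.
by move=> Qc Qd x /(fsubsetP (msuppD_le c d)); rewrite inE => /orP[/Qc|/Qd].
Qed.

Lemma supp_inZ a c : supp_in Q c -> supp_in Q (a *: c).
Proof.
move=> Qc x; rewrite -mcoeff_neq0 mcoeffZ => acx; apply: Qc.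
by rewrite -mcoeff_neq0; apply: contraNneq acx => ->; rewrite mulr0.
Qed.

Lemma supp_in_sum (I : Type) (r : seq I) (P : pred I) F :
  (forall i, P i -> supp_in Q (F i)) -> supp_in Q (\sum_(i <- r | P i) F i).
Proof.
move=> QF; elim/big_ind : _ => //; [exact: supp_in0 | exact: supp_inD].
Qed.

Lemma supp_inU x : Q x -> supp_in Q << x >>.
Proof. by move=> Qx y /(fsubsetP msuppU_le); rewrite inE => /eqP ->. Qed.

End Closure.

Lemma supp_in_linext (T T' : choiceType) (Q : T -> Prop) (Q' : T' -> Prop)
    (f : T -> {malg G[T']}) c :
  supp_in Q c -> (forall x, Q x -> supp_in Q' (f x)) -> supp_in Q' (linext f c).
Proof.
move=> Qc QQ'; rewrite /linext big_seq; apply: supp_in_sum => x /Qc/QQ'.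
exact: supp_inZ.
Qed.

Lemma supp_in_map (T T' : choiceType) (Q : T -> Prop) (Q' : T' -> Prop)
    (g : T -> T') c :
  supp_in Q c -> (forall x, Q x -> Q' (g x)) ->
  supp_in Q' (linext (fun x => << g x >> : {malg G[T']}) c).
Proof.
by move=> Qc QQ'; apply: supp_in_linext Qc _ => x /QQ'; exact: supp_inU.
Qed.

Lemma eq_linext_in (T : choiceType) (M : lmodType G) (f g : T -> M)
    (Q : T -> Prop) c :
  supp_in Q c -> (forall x, Q x -> f x = g x) -> linext f c = linext g c.
Proof.
by move=> Qc fg; rewrite /linext; apply: eq_big_seq => x /Qc/fg ->.
Qed.

Lemma eq_linext (T : choiceType) (M : lmodType G) (f g : T -> M) :
  f =1 g -> linext f =1 linext g.
Proof. by move=> fg c; apply: (@eq_linext_in _ _ _ _ (fun=> True)). Qed.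

Lemma linear_linext (T : choiceType) (M N : lmodType G) (h : {linear M -> N})
    (f : T -> M) c : h (linext f c) = linext (fun x => h (f x)) c.
Proof.
by rewrite /linext linear_sum; apply: eq_bigr => x _; rewrite linearZ.
Qed.

Lemma linextZ (T : choiceType) (M : lmodType G) (f : T -> M) a c :
  linext (fun x => a *: f x) c = a *: linext f c.
Proof.
rewrite /linext scaler_sumr; apply: eq_bigr => x _.
by rewrite !scalerA mulrC.
Qed.

Lemma linextD (T : choiceType) (M : lmodType G) (f g : T -> M) c :
  linext (fun x => f x + g x) c = linext f c + linext g c.
Proof.
by rewrite /linext -big_split; apply: eq_bigr => x _; rewrite scalerDr.
Qed.

Lemma linextB (T : choiceType) (M : lmodType G) (f g : T -> M) c :
  linext (fun x => f x - g x) c = linext f c - linext g c.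
Proof.
by rewrite /linext -sumrB; apply: eq_bigr => x _; rewrite scalerBr.
Qed.

Lemma linext_id (T : choiceType) c :
  linext (fun x => << x >> : {malg G[T]}) c = c.
Proof.
by apply: (linextP (f := linext _) (g := idfun)) => x; rewrite /= linextU.
Qed.

Lemma linear_linextE (T : choiceType) (M : lmodType G)
    (h : {linear {malg G[T]} -> M}) c : h c = linext (fun x => h << x >>) c.
Proof. by rewrite -linear_linext linext_id. Qed.

Lemma eq_linear_in (T : choiceType) (M : lmodType G)
    (h h' : {linear {malg G[T]} -> M}) (Q : T -> Prop) c :
  supp_in Q c -> (forall x, Q x -> h << x >> = h' << x >>) -> h c = h' c.
Proof.
move=> Qc hh'; rewrite linear_linextE [RHS]linear_linextE.
exact: (eq_linext_in Qc).
Qed.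

End Support.

(** * Ordered chains and their barycentric subdivision *)

Section OrderedChains.
Variable G : comNzRingType.

(** Repetitions are allowed and no complex is fixed, so cones and images under any map stay defined;
    conditions of shape are left to [supp_in]. *)
Definition oseq (W : choiceType) (k : nat) : choiceType := {ffun 'I_k.+1 -> W}.

Local Notation O W k := {malg G[oseq W k]}.

Definition oface (W : choiceType) k (i : 'I_k.+2) (y : oseq W k.+1) :
  oseq W k := [ffun a => y (lift i a)].

Definition oseq_map (W W' : choiceType) (f : W -> W') k (y : oseq W k) :
  oseq W' k := [ffun a => f (y a)].

Definition oseq_rcons (W : choiceType) (w : W) k (y : oseq W k) : oseq W k.+1 :=
  [ffun a => if unlift ord_max a is Some b then y b else w].

Definition ofront (W : choiceType) k (y : oseq W k.+1) : oseq W k :=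
  oface ord_max y.

Definition opush (W W' : choiceType) (f : W -> W') k : O W k -> O W' k :=
  linext (fun y => << oseq_map f y >>).
HB.instance Definition _ W W' f k := GRing.Linear.on (@opush W W' f k).

Definition ocone (W : choiceType) (w : W) k : O W k -> O W k.+1 :=
  linext (fun y => << oseq_rcons w y >>).
HB.instance Definition _ W w k := GRing.Linear.on (@ocone W w k).

Definition obnd (W : choiceType) k : O W k.+1 -> O W k := alt_bnd G (@oface W).
HB.instance Definition _ W k := GRing.Linear.on (@obnd W k).

Lemma oface_oface (W : choiceType) k (i j : 'I_k.+2) (y : oseq W k.+2) :
  (i <= j)%N ->
  oface i (oface (lift ord0 j) y) = oface j (oface (widen_ord (leqnSn _) i) y).
Proof. by move=> ij; apply/ffunP => a; rewrite !ffunE lift_lift. Qed.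

Lemma obnd_obnd (W : choiceType) k (c : O W k.+2) : obnd (obnd c) = 0.
Proof. exact: (alt_bnd_bnd (@oface_oface W)). Qed.

Lemma obndU (W : choiceType) k (y : oseq W k.+1) :
  obnd << y >> = \sum_(i < k.+2) (-1) ^+ i *: << oface i y >> :> O W k.
Proof. exact: alt_bndU. Qed.

Lemma oseq_map_comp (W W' W'' : choiceType) (f : W' -> W'') (g : W -> W') k
  (y : oseq W k) : oseq_map f (oseq_map g y) = oseq_map (f \o g) y.
Proof. by apply/ffunP => a; rewrite !ffunE. Qed.

Lemma opushU (W W' : choiceType) (f : W -> W') k (y : oseq W k) :
  opush f << y >> = << oseq_map f y >> :> O W' k.
Proof. exact: linextU. Qed.

Lemma opush_comp (W W' W'' : choiceType) (f : W' -> W'') (g : W -> W') k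
  (c : O W k) : opush f (opush g c) = opush (f \o g) c.
Proof.
rewrite /opush linear_linext; apply: eq_linext => y /=.
by rewrite linextU oseq_map_comp.
Qed.

Lemma opush_bnd (W W' : choiceType) (f : W -> W') k (c : O W k.+1) :
  obnd (opush f c) = opush f (obnd c).
Proof.
apply: (linextP (f := @obnd _ _ \o @opush _ _ f _)
                (g := @opush _ _ f _ \o @obnd _ _)) => y /=.
rewrite opushU !obndU linear_sum; apply: eq_bigr => i _.
rewrite linearZ /= opushU; congr (_ *: << _ >>).
by apply/ffunP => a; rewrite !ffunE.
Qed.

Lemma eq_opush_in (W W' : choiceType) (f g : W -> W') k (Q : oseq W k -> Prop)
    (c : O W k) :
  supp_in Q c -> (forall y, Q y -> forall a, f (y a) = g (y a)) ->
  opush f c = opush g c.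
Proof.
move=> Qc fg; apply: (eq_linext_in Qc) => y /fg fgy.
by congr << _ >>; apply/ffunP => a; rewrite !ffunE.
Qed.

Lemma oconeU (W : choiceType) (w : W) k (y : oseq W k) :
  ocone w << y >> = << oseq_rcons w y >> :> O W k.+1.
Proof. exact: linextU. Qed.

Lemma ofront_rcons (W : choiceType) (w : W) k (y : oseq W k) :
  ofront (oseq_rcons w y) = y.
Proof. by apply/ffunP => a; rewrite !ffunE liftK. Qed.

Lemma oseq_rcons_front (W : choiceType) k (y : oseq W k.+1) :
  oseq_rcons (y ord_max) (ofront y) = y.
Proof. by apply/ffunP => a; rewrite !ffunE; case: unliftP => [b|] ->; rewrite ?ffunE. Qed.

Lemma lift_max_lift k (i : 'I_k.+2) (a : 'I_k.+1) :
  lift (lift ord_max i) (lift ord_max a) = lift ord_max (lift i a).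
Proof. by apply: val_inj; rewrite /= /bump /=; case: i a => [i ?] [a ?] /=; lia. Qed.

Lemma lift_max_max k (i : 'I_k.+1) : lift (lift ord_max i) ord_max = ord_max.
Proof. by apply: val_inj; rewrite /= /bump /=; case: i => [i ?] /=; lia. Qed.

Lemma oface_rcons (W : choiceType) (w : W) k (i : 'I_k.+2) (y : oseq W k.+1) :
  oface (lift ord_max i) (oseq_rcons w y) = oseq_rcons w (oface i y).
Proof.
apply/ffunP => a; rewrite !ffunE; case: (unliftP ord_max a) => [b|] ->.
  by rewrite lift_max_lift liftK !ffunE.
by rewrite lift_max_max unlift_none.
Qed.

Lemma big_ord_lift_max (M : nmodType) k (F : 'I_k.+1 -> M) :
  \sum_(i < k.+1) F i = \sum_(i < k) F (lift ord_max i) + F ord_max.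
Proof.
rewrite big_ord_recr /=; congr (_ + _); apply: eq_bigr => i _.
by congr (F _); apply: val_inj; rewrite [RHS]lift_max.
Qed.

(** The apex comes last, so the face opposite to it has the sign of the last position. Positive
    degree keeps the formula free of an augmentation term. *)
Lemma ocone_bnd (W : choiceType) (w : W) k (c : O W k.+1) :
  obnd (ocone w c) = ocone w (obnd c) + (-1) ^+ k.+2 *: c.
Proof.
rewrite (linear_linextE (@ocone W w _)) linear_linext.
rewrite (linear_linextE (@obnd W _) c) linear_linext -[in X in _ + X](linext_id c).
rewrite -linextZ -linextD; apply: eq_linext => y /=.
rewrite oconeU !obndU big_ord_lift_max -/(ofront _) ofront_rcons linear_sum.
congr (_ + _); apply: eq_bigr => i _.
by rewrite lift_max linearZ /= oconeU oface_rcons.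
Qed.

Definition oconst (W : choiceType) (w : W) : oseq W 0 := [ffun=> w].

Lemma oconstE (W : choiceType) (y : oseq W 0) : y = oconst (y ord0).
Proof. by apply/ffunP => a; rewrite ffunE ord1. Qed.

Lemma obnd1 (W : choiceType) (y : oseq W 1) :
  obnd << y >> = << oconst (y ord_max) >> - << oconst (y ord0) >> :> O W 0.
Proof.
rewrite obndU !big_ord_recl big_ord0 addr0 expr0 expr1 scale1r scaleN1r.
rewrite [oface ord0 y]oconstE [oface (lift _ _) y]oconstE !ffunE.
have -> : lift ord0 ord0 = ord_max :> 'I_2 by apply: val_inj.
by have -> : lift ord_max ord0 = ord0 :> 'I_2 by apply: val_inj.
Qed.

End OrderedChains.
Arguments opush {G W W'} f {k}.
Arguments ocone {G W} w {k}.
Arguments obnd {G W k}.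

Section Subdivision.
Variable G : comNzRingType.

Local Notation O W k := {malg G[oseq W k]}.

Definition oim (W : finType) k (y : oseq W k) : {set W} := [set y a | a : 'I_k.+1].

(** The barycenter of [y] is its vertex set. Joining it last makes the flags increase, and the sign
    compensates for the position of the apex. *)
Fixpoint sdU (W : finType) k : oseq W k -> O {set W} k :=
  match k with
  | 0 => fun y => << oconst (oim y) >>
  | k'.+1 => fun y => (-1) ^+ k'.+1 *:
      ocone (oim y) (\sum_(i < k'.+2) (-1) ^+ i *: sdU (oface i y))
  end.

Definition sd (W : finType) k : O W k -> O {set W} k := linext (@sdU W k).
HB.instance Definition _ W k := GRing.Linear.on (@sd W k).

Lemma sd_gen (W : finType) k (y : oseq W k) : sd << y >> = sdU y.
Proof. exact: linextU. Qed.

Lemma sd0 (W : finType) (y : oseq W 0) : sd << y >> = << oconst (oim y) >>.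
Proof. exact: linextU. Qed.

Lemma sdS (W : finType) k (y : oseq W k.+1) :
  sd << y >> = (-1) ^+ k.+1 *: ocone (oim y) (sd (obnd << y >>)).
Proof.
rewrite sd_gen /=; congr (_ *: ocone _ _).
by rewrite obndU linear_sum; apply: eq_bigr => i _; rewrite linearZ /= sd_gen.
Qed.

Lemma sd_bnd (W : finType) k (c : O W k.+1) : obnd (sd c) = sd (obnd c).
Proof.
elim: k c => [|k IH] c;
  apply: (linextP (f := @obnd _ _ _ \o @sd _ _) (g := @sd _ _ \o @obnd _ _ _)) => y.
  rewrite /= sdS obnd1 !(linearB, linearZ) /= !sd0 !oconeU !obnd1.
  rewrite expr1 scaleN1r opprB !ffunE unlift_none.
  have -> : unlift ord_max (ord0 : 'I_2) = Some ord0 by rewrite -(liftK ord_max);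
    congr unlift; exact: val_inj.
  by rewrite !ffunE; apply/eqP; rewrite addrC opprB addrA subrK.
rewrite /= sdS linearZ /= ocone_bnd IH obnd_obnd !linear0 add0r scalerA.
by rewrite -expr2 sqrr_sign scale1r.
Qed.

Lemma oim_map (W W' : finType) (f : W -> W') k (y : oseq W k) :
  oim (oseq_map f y) = f @: oim y.
Proof.
apply/setP => w; apply/idP/idP => /imsetP[].
  by move=> a _ ->; rewrite ffunE !imset_f.
by move=> v /imsetP[a _ ->] ->; apply/imsetP; exists a; rewrite ?ffunE.
Qed.

Lemma opush_cone (W W' : choiceType) (f : W -> W') w k (c : O W k) :
  opush f (ocone w c) = ocone (f w) (opush f c).
Proof.
apply: (linextP (f := @opush _ _ _ f _ \o @ocone _ _ w _)
                (g := @ocone _ _ (f w) _ \o @opush _ _ _ f _)) => y /=.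
rewrite oconeU !opushU oconeU; congr << _ >>; apply/ffunP => a.
by rewrite !ffunE; case: unliftP => [b|] _; rewrite ?ffunE.
Qed.

Lemma opush_sd (W W' : finType) (f : W -> W') k (c : O W k) :
  opush (fun S : {set W} => f @: S) (sd c) = sd (opush f c).
Proof.
elim: k c => [|k IH] c;
  apply: (linextP (f := @opush _ _ _ (fun S : {set W} => f @: S) _ \o @sd _ _)
                  (g := @sd _ _ \o @opush _ _ _ f _)) => y /=.
  rewrite opushU !sd0 opushU; congr << _ >>; apply/ffunP => a.
  by rewrite !ffunE oim_map.
rewrite opushU !sdS linearZ /= opush_cone IH -opush_bnd opushU.
by rewrite oim_map.
Qed.

Lemma oim_face (W : finType) k (i : 'I_k.+2) (y : oseq W k.+1) :
  oim (oface i y) \subset oim y.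
Proof. by apply/fintype.subsetP => _ /imsetP[a _ ->]; rewrite ffunE imset_f. Qed.

Lemma oface_inj (W : choiceType) k (i : 'I_k.+2) (y : oseq W k.+1) :
  injective y -> injective (oface i y).
Proof. by move=> y_inj a b; rewrite !ffunE => /y_inj/lift_inj. Qed.

Lemma oim_face_proper (W : finType) k (i : 'I_k.+2) (y : oseq W k.+1) :
  injective y -> oim (oface i y) \proper oim y.
Proof.
move=> y_inj; rewrite fintype.properE oim_face; apply/fintype.subsetPn; exists (y i).
  exact: imset_f.
apply/imsetP => -[a _]; rewrite ffunE => /y_inj/eqP.
by rewrite (negbTE (neq_lift _ _)).
Qed.

Definition flag_of (W : finType) k (y : oseq W k) (u : oseq {set W} k) : Prop :=
  [/\ forall a b : 'I_k.+1, (a < b)%N -> u a \proper u b,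
      forall a, u a != finset.set0 & u ord_max = oim y].

(** Injectivity makes the vertex set of every face strictly smaller than that of [y], so coning over
    the boundary prolongs flags strictly. *)
Lemma sd_flag (W : finType) k (y : oseq W k) :
  injective y -> supp_in (flag_of y) (sd << y >> : O _ k).
Proof.
elim: k y => [|k IH] y y_inj.
  rewrite sd0; apply: supp_inU; split=> [a b|a|]; rewrite ?ffunE //.
    by rewrite [a]ord1 [b]ord1.
  by apply/finset.set0Pn; exists (y ord0); exact: imset_f.
rewrite sdS; apply: supp_inZ; rewrite /ocone.
pose Q (u : oseq {set W} k) := [/\ forall a b : 'I_k.+1, (a < b)%N -> u a \proper u b,
      forall a, u a != finset.set0 & u ord_max \proper oim y].
apply: (supp_in_map (Q := Q)).
  rewrite obndU linear_sum; apply: supp_in_sum => i _; rewrite linearZ.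
  apply: supp_inZ => u /IH[|? ? um]; first exact: oface_inj.
  by split=> //; rewrite um; exact: oim_face_proper.
move=> u [u_incr u_neq0 um]; split.
- move=> a b ab; rewrite !ffunE.
  case: (unliftP ord_max a) ab => [a'|] ->; last first.
    by rewrite ltnNge -ltnS ltn_ord.
  case: (unliftP ord_max b) => [b'|] -> ab.
    by apply: u_incr; rewrite !lift_max in ab.
  apply: fintype.sub_proper_trans um; case: (ltngtP a' (@ord_max k)) => [/u_incr/fintype.proper_sub//||].
    by rewrite ltnNge -ltnS ltn_ord.
  by move=> /val_inj ->.
- move=> a; rewrite ffunE; case: unliftP => [a'|] _; first exact: u_neq0.
  by apply/finset.set0Pn; exists (y ord0); exact: imset_f.
- by rewrite ffunE unlift_none.
Qed.

Lemma flag_of_sub (W : finType) k (y : oseq W k) (u : oseq {set W} k) (a b : 'I_k.+1) :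
  flag_of y u -> (a <= b)%N -> u a \subset u b.
Proof.
move=> [u_incr _ _]; rewrite leq_eqVlt => /orP[/eqP/val_inj -> //|/u_incr].
exact: fintype.proper_sub.
Qed.

Lemma flag_of_im (W : finType) k (y : oseq W k) (u : oseq {set W} k) a :
  flag_of y u -> u a \subset oim y.
Proof. by move=> yu; case: (yu) => _ _ <-; apply: flag_of_sub yu _; exact: leq_ord. Qed.

Lemma flag_of_inj (W : finType) k (y : oseq W k) (u : oseq {set W} k) :
  flag_of y u -> injective u.
Proof.
move=> [u_incr _ _] a b uab; apply: val_inj.
by case: (ltngtP a b) => // /u_incr; rewrite uab fintype.properxx.
Qed.

Lemma obnd_front (W : choiceType) k (M : lmodType G) (f : {linear O W k -> M})
    (x : oseq W k.+1) :
  (forall i, f << oface (lift ord_max i) x >> = 0) ->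
  f (obnd << x >>) = (-1) ^+ k.+1 *: f << ofront x >>.
Proof.
move=> f0; rewrite obndU big_ord_lift_max linearD linear_sum big1 ?add0r.
  by rewrite linearZ.
by move=> i _; rewrite linearZ /= f0 scaler0.
Qed.

(* The last-vertex map, here [t], collapses every simplex of the subdivision except
   one, so that normalized chains do not see the subdivision. *)
Lemma sd_last_vertex (W : finType) k (x : oseq W k) (Z : choiceType)
    (t : {set W} -> Z) (z : oseq Z k) (M : lmodType G) (N : {linear O Z k -> M}) :
  injective x ->
  (forall (S : {set W}) a, S \subset oim x -> x a \in S ->
     (forall b, x b \in S -> (b <= a)%N) -> t S = z a) ->
  (forall (y : oseq Z k) (a b : 'I_k.+1),
     b = a.+1 :> nat -> y a = y b -> N << y >> = 0) ->
  N (opush t (sd << x >>)) = N << z >>.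
Proof.
elim: k x z N => [|k IH] x z N x_inj tz N0.
  rewrite sd0 opushU; congr (N << _ >>); apply/ffunP => a; rewrite !ffunE ord1.
  apply: tz => //; first exact: imset_f.
  by move=> b _; rewrite [b]ord1.
have tmax (S : {set W}) : S \subset oim x -> x ord_max \in S -> t S = z ord_max.
  by move=> Sx xS; apply: tz => // b _; exact: leq_ord.
pose h := N \o @ocone _ _ (z ord_max) k \o @opush _ _ _ t k : {linear _ -> M}.
(* These faces keep the last vertex of [x], so their barycenters, like that of [x], are sent to
   [z ord_max]; the cone repeats a vertex and [N] kills it. *)
have hface (i : 'I_k.+1) : h (sd << oface (lift ord_max i) x >>) = 0.
  transitivity ((\0 : {linear _ -> M}) (sd << oface (lift ord_max i) x >>)) => //.
  apply: (eq_linear_in (h := h) (sd_flag (oface_inj (i := lift ord_max i) x_inj))).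
  move=> u [_ _ umax]; rewrite /h /= opushU oconeU.
  apply: (N0 _ (lift ord_max ord_max) ord_max); first by rewrite lift_max.
  rewrite !ffunE liftK unlift_none ffunE umax tmax ?oim_face //.
  by apply/imsetP; exists ord_max; rewrite ?ffunE ?lift_max_max.
rewrite sdS !linearZ /= opush_cone tmax ?imset_f //.
rewrite -[X in _ *: X]/((h \o @sd _ _ : {linear _ -> _}) (obnd << x >>)).
(* Only the front face survives. Its sign in the boundary cancels the sign in [sdS], and induction
   applies to [N] composed with the cone. *)
rewrite obnd_front // scalerA -expr2 sqrr_sign scale1r.
rewrite -[LHS]/((N \o @ocone _ _ (z ord_max) _ : {linear _ -> _})
                    (opush t (sd << ofront x >>))).
rewrite (IH (ofront x) (ofront z)) /= ?oconeU ?oseq_rcons_front //.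
- exact: oface_inj.
- move=> S a Sx xaS amax; rewrite ffunE; apply: tz.
  + exact: fintype.subset_trans Sx (oim_face _ _).
  + by rewrite ffunE in xaS.
  + move=> b xb; case: (unliftP ord_max b) xb => [b'|] -> xb.
      by rewrite !lift_max; apply: amax; rewrite ffunE.
    have /imsetP[b' _] := fintype.subsetP Sx _ xb; rewrite ffunE => /x_inj/eqP.
    by rewrite (negbTE (neq_lift _ _)).
- move=> y a b ab yab; rewrite /= oconeU.
  apply: (N0 _ (lift ord_max a) (lift ord_max b)); first by rewrite !lift_max.
  by rewrite !ffunE !liftK.
Qed.

End Subdivision.

(** * Prisms *)

Section Prism.
Variables (G : comNzRingType) (W : choiceType).

Local Notation O W k := {malg G[oseq W k]}.
Local Notation WI := (W * bool)%type.

(* [phi] will live at level [true] and [psi] at level [false]. *)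
Definition level (e : bool) (w : W) : WI := (w, e).

(** This is the usual prism operator, with sign (-1)^i for the simplex that climbs at vertex [i]:
    each simplex ends at the top copy of the last vertex, and either climbs there or extends one of
    the prism over the front face. *)
Fixpoint prismU k : oseq W k -> O WI k.+1 :=
  match k with
  | 0 => fun y => ocone (level true (y ord0)) << oseq_map (level false) y >>
  | k'.+1 => fun y => ocone (level true (y ord_max))
      (prismU (ofront y) + (-1) ^+ k'.+1 *: << oseq_map (level false) y >>)
  end.

Definition prism k : O W k -> O WI k.+1 := linext (@prismU k).
HB.instance Definition _ k := GRing.Linear.on (@prism k).

Lemma prism_gen k (y : oseq W k) : prism << y >> = prismU y.
Proof. exact: linextU. Qed.

Lemma prism0 (y : oseq W 0) :
  prism << y >> = ocone (level true (y ord0)) << oseq_map (level false) y >>.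
Proof. exact: prism_gen. Qed.

Lemma prismS k (y : oseq W k.+1) :
  prism << y >> = ocone (level true (y ord_max))
    (prism << ofront y >> + (-1) ^+ k.+1 *: << oseq_map (level false) y >>).
Proof. by rewrite !prism_gen. Qed.

Lemma oseq_map_rcons (Z Z' : choiceType) (f : Z -> Z') w k (y : oseq Z k) :
  oseq_rcons (f w) (oseq_map f y) = oseq_map f (oseq_rcons w y).
Proof.
by apply/ffunP => a; rewrite !ffunE; case: unliftP => [b|] _; rewrite ?ffunE.
Qed.

Lemma prism_bnd0 (c : O W 0) :
  obnd (prism c) = opush (level true) c - opush (level false) c.
Proof.
apply: (linextP (f := @obnd _ _ _ \o @prism _)
  (g := @opush _ _ _ (level true) _ \- @opush _ _ _ (level false) _)) => y /=.
rewrite prism0 oconeU obnd1 !opushU [oseq_map (level true) y]oconstE.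
rewrite [oseq_map (level false) y]oconstE !ffunE unlift_none.
have -> : unlift ord_max (ord0 : 'I_2) = Some ord0 by rewrite -(liftK ord_max);
    congr unlift; exact: val_inj.
by rewrite ffunE.
Qed.

Lemma oface_max k (i : 'I_k.+1) (y : oseq W k.+1) :
  oface (lift ord_max i) y ord_max = y ord_max.
Proof. by rewrite ffunE lift_max_max. Qed.

Lemma ofront_face k (i : 'I_k.+2) (y : oseq W k.+2) :
  ofront (oface (lift ord_max i) y) = oface i (ofront y).
Proof. by apply/ffunP => a; rewrite !ffunE lift_max_lift. Qed.

Lemma obnd_lift_max k (y : oseq W k.+1) :
  obnd << y >> = \sum_(i < k.+1) (-1) ^+ i *: << oface (lift ord_max i) y >>
                 + (-1) ^+ k.+1 *: << ofront y >> :> O W k.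
Proof.
rewrite obndU big_ord_lift_max.
by under eq_bigr => i _ do rewrite lift_max.
Qed.

Lemma obnd_map k (f : W -> WI) (y : oseq W k.+1) :
  obnd << oseq_map f y >> = opush f (obnd << y >>) :> O WI k.
Proof. by rewrite -opush_bnd opushU. Qed.

Lemma prism_bndSU k (y : oseq W k.+1) :
  obnd (prism << y >>) =
  << oseq_map (level true) y >> - << oseq_map (level false) y >>
  - prism (obnd << y >>).
Proof.
elim: k y => [|k IH] y; set w := level true (y ord_max).
  rewrite prismS -/w ocone_bnd [obnd (_ + _)]linearD /= [obnd (prism _)]prism_bnd0 !opushU.
  rewrite [obnd (_ *: _)]linearZ /= obnd_map.
  (* Degree one stands apart because the faces of [y] are points, to which [prismS] does not
     apply. *)
  have [x [xmax ->]] : exists x : oseq W 0,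
      x ord0 = y ord_max /\ obnd << y >> = << x >> - << ofront y >> :> O W 0.
    exists (oconst (y ord_max)); rewrite obnd1; split; first by rewrite ffunE.
    congr (_ - << _ >>); rewrite [ofront y]oconstE ffunE; congr (oconst (y _)).
    exact: val_inj.
  rewrite [opush _ (_ - _)]linearB [prism (_ - _)]linearB /= !opushU.
  rewrite [prism << x >>]prism0 xmax -/w expr1 scaleN1r sqrrN expr1n scale1r.
  have cancel (V : zmodType) (a b c : V) : a - b - (c - b) = a - c.
    by rewrite opprB addrA subrK.
  rewrite cancel.
  rewrite [ocone w (_ - _)]linearB /= oconeU oseq_map_rcons oseq_rcons_front.
  by rewrite scaleN1r opprB [X in _ + X = _]addrC addrACA [- _ + _]addrC.
rewrite prismS -/w ocone_bnd [obnd (_ + _)]linearD /= IH [obnd (_ *: _)]linearZ /= obnd_map.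
(* Every face but the front one keeps the last vertex, so all their prisms are cones with the same
   apex [w]. *)
have -> : prism (obnd << y >>) = ocone w (prism (obnd << ofront y >>)
    + (-1) ^+ k.+1 *: (\sum_(i < k.+2) (-1) ^+ i *: << oseq_map (level false) (oface (lift ord_max i) y) >>))
   + (-1) ^+ k.+2 *: prism << ofront y >>.
  rewrite obnd_lift_max [LHS]linearD /= [prism (\sum_(_ < _) _)]linear_sum.
  rewrite [prism (_ *: _)]linearZ /=; congr (_ + _).
  rewrite obndU [prism (\sum_(_ < _) _)]linear_sum scaler_sumr -big_split.
  rewrite [RHS]linear_sum; apply: eq_bigr => i _.
  rewrite /= ![prism (_ *: _)]linearZ /= prismS oface_max -/w ofront_face.
  by rewrite scalerA mulrC -scalerA -scalerDr [ocone w (_ *: _)]linearZ.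
rewrite (obnd_lift_max y) [opush _ (_ + _)]linearD /= [opush _ (\sum_(_ < _) _)]linear_sum /=.
rewrite [opush _ (_ *: _)]linearZ /= opushU.
rewrite (_ : \sum_(i < k.+2) _ = \sum_(i < k.+2) (-1) ^+ i *:
    << oseq_map (level false) (oface (lift ord_max i) y) >>); last first.
  by apply: eq_bigr => i _; rewrite [opush _ (_ *: _)]linearZ /= opushU.
set S := \sum_(_ < _) _; set a := << _ >>; set b := << _ >>; set p := prism _.
(* The bottom of the prism over the front face cancels against the front face of the bottom copy of
   [y]. *)
have -> : a - b - p + (-1) ^+ k.+2 *: (S + (-1) ^+ k.+2 *: b)
    = a - (p + (-1) ^+ k.+1 *: S).
  rewrite scalerDr scalerA -expr2 sqrr_sign scale1r [in LHS]exprS mulN1r scaleNr.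
  by rewrite addrAC [- _ + b]addrC addrA subrK opprD addrA addrAC.
rewrite [ocone w (_ - _)]linearB /= oconeU oseq_map_rcons oseq_rcons_front.
set c := ocone w _; set q := prism _; set d := << oseq_map (level false) y >>.
have -> : (-1) ^+ k.+3 *: (q + (-1) ^+ k.+2 *: d) = - ((-1) ^+ k.+2 *: q) - d.
  by rewrite exprS mulN1r scaleNr scalerDr scalerA -expr2 sqrr_sign scale1r opprD.
by rewrite opprD [X in _ + X = _]addrC addrACA.
Qed.

Lemma prism_bndS k (c : O W k.+1) :
  obnd (prism c) =
  opush (level true) c - opush (level false) c - prism (obnd c).
Proof.
rewrite (linear_linextE (@prism _)) linear_linext.
rewrite (eq_linext (@prism_bndSU k)) !linextB; congr (_ - _).
by rewrite -linear_linext -linear_linextE.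
Qed.

(* The prism over [y] consists of the sequences that run along [y] at level [false],
   repeat a vertex of [y] at level [true], and go on at that level to the end of [y]. *)
Definition prism_of k (y : oseq W k) (z : oseq WI k.+1) (r : 'I_k.+2 -> 'I_k.+1) :
    Prop :=
  [/\ forall a, (z a).1 = y (r a),
      forall a b : 'I_k.+2, (a < b)%N ->
        (r a <= r b)%N /\ ((z a).2 ==> (z b).2),
      forall a b : 'I_k.+2, (a < b)%N -> r a = r b -> ~~ (z a).2 && (z b).2 &
      (z ord_max).2 /\ exists a b : 'I_k.+2, b = a.+1 :> nat /\ (z a).1 = (z b).1].

Lemma ord_max_nlt k (a : 'I_k.+1) : (@ord_max k < a)%N = false.
Proof. by rewrite ltnNge -ltnS ltn_ord. Qed.

Lemma prism_of_climb k (y : oseq W k) :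
  prism_of y (oseq_rcons (level true (y ord_max)) (oseq_map (level false) y))
    (fun a => odflt ord_max (unlift ord_max a)).
Proof.
split.
- by move=> a; rewrite !ffunE; case: unliftP => [b|] _; rewrite ?ffunE.
- move=> a b; rewrite !ffunE.
  case: (unliftP ord_max a) => [a'|] ->; last by rewrite ord_max_nlt.
  case: (unliftP ord_max b) => [b'|] ->; rewrite !lift_max !ffunE /= => ab.
    by split; first exact: ltnW.
  by split; first exact: leq_ord.
- move=> a b; rewrite !ffunE.
  case: (unliftP ord_max a) => [a'|] ->; last by rewrite ord_max_nlt.
  case: (unliftP ord_max b) => [b'|] ->; rewrite !lift_max !ffunE /= => ab.
    by move=> abE; rewrite abE ltnn in ab.
  by [].
- rewrite !ffunE unlift_none; split=> //.
  exists (lift ord_max ord_max), ord_max; rewrite lift_max; split=> //.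
  by rewrite !ffunE liftK unlift_none ffunE.
Qed.

Lemma prism_supp k (y : oseq W k) :
  supp_in (fun z => exists r, prism_of y z r) (prism << y >>).
Proof.
elim: k y => [|k IH] y.
  rewrite prism0 oconeU; apply: supp_inU.
  have <- : y ord_max = y ord0 by rewrite [ord_max]ord1.
  by eexists; exact: prism_of_climb.
rewrite prismS; pose w := level true (y ord_max); rewrite -/w.
apply: (supp_in_map (Q := fun z => z = oseq_map (level false) y \/
                            exists r, prism_of (ofront y) z r)).
  apply: supp_inD; last by apply: supp_inZ; apply: supp_inU; left.
  by move=> z /IH; right.
move=> z [->|[r [zr r_mono r_strict [zmax [a0 [b0 [ab0 zab0]]]]]]].
  by eexists; exact: prism_of_climb.
exists (fun a => if unlift ord_max a is Some b then lift ord_max (r b) else ord_max).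
split.
- by move=> a; rewrite !ffunE; case: unliftP => [b|] _; rewrite ?zr ?ffunE.
- move=> a b; rewrite !ffunE.
  case: (unliftP ord_max a) => [a'|] ->; last by rewrite ord_max_nlt.
  case: (unliftP ord_max b) => [b'|] ->; rewrite !lift_max /=.
    exact: r_mono.
  by move=> _; split; [exact: ltnW | rewrite implybT].
- move=> a b; rewrite !ffunE.
  case: (unliftP ord_max a) => [a'|] ->; last by rewrite ord_max_nlt.
  case: (unliftP ord_max b) => [b'|] ->; rewrite !lift_max /=.
    by move=> ab /lift_inj; exact: r_strict.
  by move=> _ /eqP; rewrite eq_sym (negbTE (neq_lift _ _)).
- rewrite !ffunE unlift_none; split=> //.
  exists (lift ord_max a0), (lift ord_max b0); rewrite !lift_max; split=> //.
  by rewrite !ffunE !liftK.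
Qed.

(** Every other simplex of the prism has its last two vertices at the top level; [c] is the last but
    one position. The condition on [N] is the one met by [realval], see [realval_collapse]. *)
Lemma prism_collapse k (M : lmodType G) (N : {linear O WI k.+1 -> M}) (y : oseq W k) :
  (forall (z : oseq WI k.+1) (a b c : 'I_k.+2), b = a.+1 :> nat ->
     (z a).1 = (z b).1 -> c.+1 = k.+1 -> (z c).2 -> N << z >> = 0) ->
  N (prism << y >>) =
  (-1) ^+ k *: N << oseq_rcons (level true (y ord_max)) (oseq_map (level false) y) >>.
Proof.
case: k N y => [|k] N y N0.
  by rewrite prism0 oconeU expr0 scale1r [ord_max]ord1.
rewrite prismS; set w := level true _.
rewrite [ocone w (_ + _)]linearD [N (_ + _)]linearD /=.
rewrite [ocone w (_ *: _)]linearZ [N (_ *: _)]linearZ /= oconeU.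
rewrite [X in X + _](_ : _ = 0) ?add0r //.
pose h := N \o @ocone _ _ w _ : {linear _ -> _}.
transitivity ((\0 : {linear _ -> M}) (prism << ofront y >>)) => //.
apply: (eq_linear_in (h := h) (@prism_supp _ (ofront y))).
move=> z [r [_ _ _ [zmax [a [b [ab zab]]]]]]; rewrite /h /= oconeU.
apply: (N0 _ (lift ord_max a) (lift ord_max b) (lift ord_max ord_max)).
- by rewrite !lift_max.
- by rewrite !ffunE !liftK.
- by rewrite lift_max.
- by rewrite ffunE liftK.
Qed.

End Prism.

(** * Normalized chains *)

Section Increasing.

Definition incr m n (h : 'I_m.+1 -> 'I_n.+1) : Prop :=
  forall a b : 'I_m.+1, (a < b)%N -> (h a < h b)%N.

Lemma incr_leq m n (h : 'I_m.+1 -> 'I_n.+1) (a b : 'I_m.+1) :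
  incr h -> (h a <= h b)%N = (a <= b)%N.
Proof.
move=> hi; apply/idP/idP; first by apply: contraTT; rewrite -!ltnNge; exact: hi.
by rewrite leq_eqVlt => /orP[/eqP/val_inj -> //|/hi/ltnW].
Qed.

Lemma incr_ltn m n (h : 'I_m.+1 -> 'I_n.+1) (a b : 'I_m.+1) :
  incr h -> (h a < h b)%N = (a < b)%N.
Proof. by move=> hi; rewrite !ltnNge incr_leq. Qed.

Lemma incr_inj m n (h : 'I_m.+1 -> 'I_n.+1) : incr h -> injective h.
Proof.
move=> hi a b hab; apply: val_inj; apply/eqP.
by rewrite eqn_leq -!(incr_leq _ _ hi) hab leqnn.
Qed.

Lemma incr_comp l m n (h : 'I_m.+1 -> 'I_n.+1) (g : 'I_l.+1 -> 'I_m.+1) :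
  incr h -> incr g -> incr (h \o g).
Proof. by move=> hi gi a b /gi/hi. Qed.

Lemma incr_lift n (i : 'I_n.+2) : incr (lift i).
Proof. by move=> a b ab; rewrite /= /bump; lia. Qed.

Lemma incr_id n : incr (@id 'I_n.+1).
Proof. by []. Qed.

Lemma sorted_val_enum n (W : {set 'I_n.+1}) :
  sorted ltn [seq val x | x <- enum W].
Proof.
rewrite sorted_map; apply: sorted_filter => [x y z /=|]; first exact: ltn_trans.
by rewrite -enumT -(@sorted_map _ _ val) val_enum_ord iota_ltn_sorted.
Qed.

(** Both sides are sorted with the same members. An increasing map is thus determined by its image,
    which makes the inclusion of a face unique. *)
Lemma incr_val_seq m n (g : 'I_m.+1 -> 'I_n.+1) : incr g ->
  [seq val (g a) | a <- enum 'I_m.+1] = [seq val x | x <- enum (g @: [set: 'I_m.+1]%SET)].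
Proof.
move=> gi; apply: (irr_sorted_eq ltn_trans ltnn) => [||x].
- rewrite sorted_map; apply: (@sub_sorted _ (relpre val ltn)).
    by move=> a b; exact: gi.
  by rewrite -(@sorted_map _ _ val) val_enum_ord iota_ltn_sorted.
- exact: sorted_val_enum.
- apply/mapP/mapP => [[a _ ->]|[y]].
    by exists (g a); rewrite // mem_enum imset_f // inE.
  by rewrite mem_enum => /imsetP[a _ ->] ->; exists a; rewrite ?mem_enum.
Qed.

Lemma incr_im_dim m m' n (g : 'I_m.+1 -> 'I_n.+1) (g' : 'I_m'.+1 -> 'I_n.+1) :
  incr g -> incr g' -> g @: [set: 'I_m.+1]%SET = g' @: [set: 'I_m'.+1]%SET -> m = m'.
Proof.
move=> /incr_inj gi /incr_inj gi' /(congr1 (fun S : {set _} => #|S|)).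
by rewrite !card_imset // !cardsT !card_ord => -[].
Qed.

Lemma incr_im_inj m n (g g' : 'I_m.+1 -> 'I_n.+1) :
  incr g -> incr g' -> g @: [set: 'I_m.+1]%SET = g' @: [set: 'I_m.+1]%SET -> g = g'.
Proof.
move=> /incr_val_seq gE /incr_val_seq g'E gg'; rewrite -gg' -gE in g'E.
apply/funext => a; apply: val_inj.
have : nth 0%N [seq val (g' b) | b <- enum 'I_m.+1] a
    = nth 0%N [seq val (g b) | b <- enum 'I_m.+1] a by rewrite g'E.
by rewrite (nth_map a) ?size_enum_ord // (nth_map a) ?size_enum_ord // !nth_ord_enum.
Qed.

Lemma incr_onto n (W : {set 'I_n.+1}) : W != finset.set0 ->
  exists m (g : 'I_m.+1 -> 'I_n.+1), incr g /\ g @: [set: 'I_m.+1]%SET = W.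
Proof.
rewrite -card_gt0 => W0; exists #|W|.-1.
have Wm : #|W|.-1.+1 = size (enum W) by rewrite prednK // cardE.
exists (fun a => nth ord0 (enum W) a); split.
  move=> a b ab; have := sorted_val_enum W.
  move=> /(sorted_ltn_nth ltn_trans 0) /(_ a b); rewrite !inE size_map -Wm !ltn_ord.
  by rewrite !(nth_map ord0) -?Wm ?ltn_ord //; exact.
apply/setP => x; apply/imsetP/idP => [[a _ ->]|xW].
  by rewrite -mem_enum mem_nth // -Wm ltn_ord.
have xi : (index x (enum W) < #|W|.-1.+1)%N by rewrite Wm index_mem mem_enum.
by exists (Ordinal xi) => //; apply/esym/nth_index; rewrite mem_enum.
Qed.

End Increasing.

Section NormalizedChains.
Variables (R : realType) (G : comNzRingType) (Y : topologicalType).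

Lemma sing_pull_comp i j k (h : 'I_j.+1 -> 'I_k.+1) (g : 'I_i.+1 -> 'I_j.+1)
    (s : singularSimplex R Y k) : sing_pull g (sing_pull h s) = sing_pull (h \o g) s.
Proof. by apply/continuousEP => t /=; rewrite simplex_map_comp. Qed.

Lemma sing_pull_id k (s : singularSimplex R Y k) : sing_pull id s = s.
Proof.
apply/continuousEP => t /=; congr (s _); apply: val_inj; apply/rowP => i.
by rewrite mxE (big_pred1 i).
Qed.

Lemma is_face_trans i j k (r : singularSimplex R Y i) (s : singularSimplex R Y j)
    (t : singularSimplex R Y k) : is_face r s -> is_face s t -> is_face r t.
Proof.
move=> [g gi ->] [h hi ->]; exists (h \o g); first by move=> a b /gi/hi.
exact: sing_pull_comp.
Qed.

Lemma is_face_refl k (s : singularSimplex R Y k) : is_face s s.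
Proof. by exists id; rewrite ?sing_pull_id. Qed.

Lemma is_face_vertex k (s : singularSimplex R Y k) :
  is_face (sing_pull (fun _ : 'I_1 => ord0) s) s.
Proof. by exists (fun=> ord0) => // a b; rewrite [a]ord1 [b]ord1. Qed.

(** Ordered chains of the standard simplex, modulo the sequences that are not strictly increasing,
    are realized by the faces of [s]. *)
Definition nsimp k (s : singularSimplex R Y k) r (M : oseq 'I_k.+1 r) :
    {malg G[singularSimplex R Y r]} :=
  if `[< incr M >] then << sing_pull M s >> else 0.

Lemma nsimp_repeat k (s : singularSimplex R Y k) r (M : oseq 'I_k.+1 r)
  (a b : 'I_r.+1) : a != b -> M a = M b -> nsimp s M = 0.
Proof.
move=> ab Mab; rewrite /nsimp; case: asboolP => // /incr_inj /(_ _ _ Mab) abE.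
by rewrite abE eqxx in ab.
Qed.

Lemma nsimp_pull j k (h : 'I_j.+1 -> 'I_k.+1) (s : singularSimplex R Y k) r
    (M : oseq 'I_j.+1 r) :
  incr h -> nsimp (sing_pull h s) M = nsimp s (oseq_map h M).
Proof.
move=> hi; rewrite /nsimp sing_pull_comp.
have -> : h \o M = oseq_map h M by apply/funext => a; rewrite ffunE.
congr (if _ then _ else _); apply: asbool_equiv_eq; split=> Mi a b ab.
  by rewrite !ffunE incr_ltn // Mi.
by have := Mi _ _ ab; rewrite !ffunE incr_ltn.
Qed.

Lemma nsimp_id k (s : singularSimplex R Y k) :
  nsimp s ([ffun a => a] : oseq 'I_k.+1 k) = << s >>.
Proof.
rewrite /nsimp; have -> : ([ffun a => a] : oseq 'I_k.+1 k) = id :> (_ -> _).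
  by apply/funext => a; rewrite ffunE.
by rewrite asboolT ?sing_pull_id.
Qed.

(** A monotone sequence that is not increasing repeats a value at two adjacent positions. Omitting
    either gives the same sequence with opposite signs, and all other faces still contain the
    repetition. *)
Lemma nsimp_bnd k (s : singularSimplex R Y k) r (M : oseq 'I_k.+1 r.+1) :
  (forall a b : 'I_r.+2, (a < b)%N -> (M a <= M b)%N) ->
  bnd (singular R G Y) r (nsimp s M)
  = \sum_(i < r.+2) (-1) ^+ i *: nsimp s (oface i M).
Proof.
move=> Mm; have [Mi|Mni] := pselect (incr M).
  rewrite {1}/nsimp asboolT //= [LHS]alt_bndU; apply: eq_bigr => i _.
  rewrite /nsimp asboolT; last first.
    by move=> a b ab; rewrite !ffunE; apply: Mi; exact: incr_lift.
  have <- : M \o lift i = oface i M :> (_ -> _).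
    by apply/funext => a; rewrite ffunE.
  by rewrite -sing_pull_comp.
have [j Mj] : exists j : 'I_r.+1, M (widen_ord (leqnSn _) j) = M (lift ord0 j).
  apply: contra_notP Mni => /forallNP Mj a b.
  have {}Mj (j : 'I_r.+1) : (M (widen_ord (leqnSn _) j) < M (lift ord0 j))%N.
    rewrite ltn_neqAle Mm ?lift0 // andbT; apply/eqP => /val_inj; exact: Mj.
  case: a b => a alt [b blt] /=; elim: b blt => // b IH blt.
  rewrite ltnS leq_eqVlt => /orP[/eqP ab|ab].
    have := Mj (Ordinal (blt : (b < r.+1)%N)).
    by congr (M _ < M _)%N; apply: val_inj => //=; rewrite ab.
  have bltr : (b < r.+2)%N by exact: ltnW.
  apply: (leq_trans (IH bltr ab)).
  by apply: Mm; rewrite /=.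
rewrite {1}/nsimp asboolF // [LHS]linear0.
pose i0 := widen_ord (leqnSn _) j; pose i1 : 'I_r.+2 := lift ord0 j.
have i01 : i1 != i0 by rewrite -val_eqE /= /bump /=; lia.
rewrite (bigD1 i0) // (bigD1 i1) // big1 => [|i /andP[ii0 ii1]].
  have -> : oface i0 M = oface i1 M.
    apply/ffunP => a; rewrite !ffunE.
    have [aj|aj] := eqVneq (a : nat) j.
      have -> : lift i0 a = i1 by apply: val_inj; rewrite /= /bump /=; lia.
      have -> : lift i1 a = i0 by apply: val_inj; rewrite /= /bump /=; lia.
      by rewrite -Mj.
    by congr (M _); apply: val_inj; rewrite /= /bump /=; lia.
  have -> : nat_of_ord i1 = i0.+1 by rewrite /i1 lift0.
  by rewrite /= addr0 [(-1) ^+ i0.+1]exprS mulN1r scaleNr subrr.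
have [a0 a0E] : exists a0, lift i a0 = i0.
  by case: (unliftP i i0) ii0 => [a0 ->|->]; [exists a0 | rewrite eqxx].
have [a1 a1E] : exists a1, lift i a1 = i1.
  by case: (unliftP i i1) ii1 => [a1 ->|->]; [exists a1 | rewrite eqxx].
rewrite (@nsimp_repeat _ _ _ _ a0 a1) ?scaler0 //.
  by apply: contra_neq i01 => a01; rewrite -a0E -a1E a01.
by rewrite !ffunE a0E a1E.
Qed.

End NormalizedChains.

(** * The second subdivision of the singular complex *)

Section Cells.
Variables (R : realType) (Y : topologicalType).

(* Only those [(k; s, F)] matter for which [F] is a flag of nonempty faces of the
   [k]-simplex containing the whole simplex. *)
Definition cell := {k : nat & (singularSimplex R Y k * {set {set 'I_k.+1}})%type}.
HB.instance Definition _ := Choice.on cell.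

Definition csimp (r : cell) : singularSimplex R Y (projT1 r) := (projT2 r).1.
Definition cflag (r : cell) : {set {set 'I_(projT1 r).+1}} := (projT2 r).2.

Definition gimg m n (h : 'I_m.+1 -> 'I_n.+1) (F : {set {set 'I_m.+1}}) :
  {set {set 'I_n.+1}} := [set h @: (S : {set _}) | S in F]%SET.

Lemma gimg_comp l m n (h : 'I_m.+1 -> 'I_n.+1) (g : 'I_l.+1 -> 'I_m.+1) F :
  gimg h (gimg g F) = gimg (h \o g) F.
Proof.
rewrite /gimg -imset_comp; apply: eq_imset => S /=.
by rewrite -imset_comp.
Qed.

Lemma cover_gimg m n (h : 'I_m.+1 -> 'I_n.+1) F :
  finset.cover (gimg h F) = h @: finset.cover F.
Proof.
apply/setP => x; apply/bigcupP/imsetP.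
  move=> [_ /imsetP[S SF ->] /imsetP[a aS ->]].
  by exists a => //; apply/bigcupP; exists S.
move=> [a /bigcupP[S SF aS] ->]; exists (h @: S); last exact: imset_f.
exact: imset_f.
Qed.

(* [r] is the restriction of [(s, F)] to the face of [s] spanned by the union of [F]. *)
Definition normal_form k (s : singularSimplex R Y k) (F : {set {set 'I_k.+1}}) (r : cell) :
    Prop :=
  exists g : 'I_(projT1 r).+1 -> 'I_k.+1,
    [/\ incr g, csimp r = sing_pull g s,
        finset.cover (cflag r) = finset.setT & gimg g (cflag r) = F].

(** By [normal_form_uniq] and [vertP] the choice is canonical once the union of [F] is nonempty; the
    default serves only the empty union. *)
Definition vert k (s : singularSimplex R Y k) (F : {set {set 'I_k.+1}}) : cell :=
  xget (existT _ k (s, F)) (normal_form s F).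

(** The image of [g] is the union of [F], and an increasing map is determined by its image;
    injectivity of [g] on sets then recovers the flag. *)
Lemma normal_form_uniq k (s : singularSimplex R Y k) F r r' :
  normal_form s F r -> normal_form s F r' -> r = r'.
Proof.
case: r => m [t C]; case: r' => m' [t' C'] [/= g [gi tE Cc CF]] [/= g' [gi' tE' Cc' CF']].
rewrite /csimp /cflag /= in tE Cc CF tE' Cc' CF'.
have gg'im : g @: finset.setT = g' @: finset.setT.
  by rewrite -Cc -Cc' -!cover_gimg CF CF'.
have mm' := incr_im_dim gi gi' gg'im; subst m'.
have gg' := incr_im_inj gi gi' gg'im; subst g'.
rewrite tE tE'; suff -> : C = C' by [].
apply: (imset_inj (f := fun S : {set _} => g @: S)).
  move=> S T; exact: (imset_inj (incr_inj gi)).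
by rewrite -[LHS]/(gimg g C) -[RHS]/(gimg g C') CF CF'.
Qed.

Lemma vertP k (s : singularSimplex R Y k) F :
  finset.cover F != finset.set0 -> normal_form s F (vert s F).
Proof.
move=> /incr_onto[m [g [gi gF]]]; apply: xgetPex.
pose C := [set S : {set 'I_m.+1} | g @: S \in F]%SET.
have CF : gimg g C = F.
  apply/setP => S; apply/imsetP/idP => [[S' + ->]|SF]; first by rewrite inE.
  have gS : g @: (g @^-1: S) = S.
    apply/setP => x; apply/imsetP/idP => [[a + ->]|xS]; first by rewrite inE.
    have : x \in finset.cover F by apply/bigcupP; exists S.
    by rewrite -gF => /imsetP[a _ xE]; exists a; rewrite // inE -xE.
  by exists (g @^-1: S); rewrite ?inE gS.
exists (existT _ m (sing_pull g s, C)), g; split => //.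
apply: (imset_inj (incr_inj gi)); rewrite -cover_gimg /= CF; exact/esym.
Qed.

(** This glues the subdivisions of all singular simplices along their faces: composing inclusions
    turns a normal form in the face into one in [s]. *)
Lemma vert_gimg j k (h : 'I_j.+1 -> 'I_k.+1) (s : singularSimplex R Y k) F :
  incr h -> finset.cover F != finset.set0 ->
  vert (sing_pull h s) F = vert s (gimg h F).
Proof.
move=> hi F0; apply: (@normal_form_uniq _ s (gimg h F)).
  have [g [gi sE gT gF]] := vertP (sing_pull h s) F0.
  exists (h \o g); split => //; first exact: incr_comp.
    by rewrite sE sing_pull_comp.
  by rewrite -gimg_comp gF.
apply: vertP; rewrite cover_gimg; have /finset.set0Pn[x xF] := F0.
by apply/finset.set0Pn; exists (h x); exact: imset_f.
Qed.

Lemma card_cflag k (s : singularSimplex R Y k) F :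
  finset.cover F != finset.set0 -> #|cflag (vert s F)| = #|F|.
Proof.
move=> /(vertP s)[g [gi _ _ CF]]; rewrite -[in RHS]CF card_imset //.
move=> S T; exact: (imset_inj (incr_inj gi)).
Qed.

End Cells.

(** * Flags of faces and last vertices *)

Section Flags.

Definition flag m (F : {set {set 'I_m.+1}}) : Prop :=
  [/\ F != finset.set0, finset.set0 \notin F &
      forall S T, S \in F -> T \in F -> (S \subset T) || (T \subset S)].

(** A member of largest cardinality contains all others, so it is the union. *)
Lemma flag_cover m (F : {set {set 'I_m.+1}}) : flag F -> finset.cover F \in F.
Proof.
move=> [/finset.set0Pn[S0 S0F] _ Fchain].
have [S SF Smax] := arg_maxnP (fun S : {set 'I_m.+1} => #|S|) S0F.
suff -> : finset.cover F = S by [].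
apply/eqP; rewrite finset.eqEsubset; apply/andP; split; last first.
  exact: (finset.bigcup_sup S).
apply/finset.bigcupsP => T TF; have /orP[//|ST] := Fchain _ _ TF SF.
suff /eqP -> : S == T by [].
by rewrite finset.eqEcard ST; exact: Smax.
Qed.

Lemma flag_cover_neq0 m (F : {set {set 'I_m.+1}}) :
  flag F -> finset.cover F != finset.set0.
Proof.
move=> Fflag; have cF := flag_cover Fflag; have [_ F0 _] := Fflag.
by apply: contraNneq F0 => <-.
Qed.

Lemma imset_subE (W W' : finType) (h : W -> W') (S T : {set W}) :
  injective h -> (h @: S \subset h @: T) = (S \subset T).
Proof.
move=> hi; apply/idP/idP => [|/imsetS]; last exact.
move=> /fintype.subsetP ST; apply/fintype.subsetP => x xS.
by rewrite -(mem_imset _ _ hi); apply: ST; exact: imset_f.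
Qed.

Lemma flag_gimgE m n (h : 'I_m.+1 -> 'I_n.+1) F : incr h -> flag (gimg h F) <-> flag F.
Proof.
move=> /incr_inj hi; split=> -[F0 F0' Fchain]; split.
- by have /finset.set0Pn[_ /imsetP[S SF _]] := F0; apply/finset.set0Pn; exists S.
- by apply: contra F0' => ?; apply/imsetP; exists finset.set0; rewrite ?imset0.
- move=> S T SF TF; rewrite -!(imset_subE _ _ hi).
  by apply: Fchain; exact: imset_f.
- have /finset.set0Pn[S SF] := F0.
  by apply/finset.set0Pn; exists (h @: S); exact: imset_f.
- apply: contra F0' => /imsetP[S SF /esym/eqP]; rewrite imset_eq0 => /eqP S0.
  by rewrite -S0.
- move=> _ _ /imsetP[S SF ->] /imsetP[T TF ->].
  by have /orP[/(imsetS h) ->//|/(imsetS h) ->] := Fchain _ _ SF TF; rewrite orbT.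
Qed.

Definition maxi m (S : {set 'I_m.+1}) : 'I_m.+1 :=
  odflt ord0 [pick a in S | [forall b in S, (b <= a)%N]].

Lemma maxiE m (S : {set 'I_m.+1}) a :
  a \in S -> (forall b, b \in S -> (b <= a)%N) -> maxi S = a.
Proof.
move=> aS amax; rewrite /maxi; case: pickP => [b /andP[bS /forall_inP bmax]|] /=.
  by apply/val_inj/anti_leq; rewrite bmax ?amax.
by move=> /(_ a); rewrite aS /= => /negP[]; apply/forall_inP.
Qed.

Lemma maxiP m (S : {set 'I_m.+1}) :
  S != finset.set0 -> maxi S \in S /\ forall b, b \in S -> (b <= maxi S)%N.
Proof.
move=> /finset.set0Pn[x xS].
have [a aS amax] := arg_maxnP (fun a : 'I_m.+1 => val a) xS.
by rewrite (maxiE aS).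
Qed.

Lemma maxi_incr m n (h : 'I_m.+1 -> 'I_n.+1) (S : {set 'I_m.+1}) :
  incr h -> S != finset.set0 -> maxi (h @: S) = h (maxi S).
Proof.
move=> hi /maxiP[mS mmax]; apply: maxiE; first exact: imset_f.
by move=> _ /imsetP[b /mmax bS ->]; rewrite incr_leq.
Qed.

Lemma maxi_mono m (S T : {set 'I_m.+1}) :
  S != finset.set0 -> S \subset T -> (maxi S <= maxi T)%N.
Proof.
move=> S0 /fintype.subsetP ST; have [mS _] := maxiP S0.
have /maxiP[_ maxT] : T != finset.set0.
  by apply/finset.set0Pn; exists (maxi S); exact: ST.
exact/maxT/ST.
Qed.

End Flags.

(** * Simplices of the second subdivision and the last-vertex map *)

Section CellSequences.
Variables (R : realType) (G : comNzRingType) (Y : topologicalType).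

(** Inclusions need not be strict, since the sequences of a prism repeat a flag. *)
Definition nested k r (u : oseq {set {set 'I_k.+1}} r) : Prop :=
  (forall i, flag (u i)) /\
  (forall i j : 'I_r.+1, (i < j)%N -> u i \subset u j).

Definition represents k (s : singularSimplex R Y k) r
    (u : oseq {set {set 'I_k.+1}} r) (y : oseq (cell R Y) r) : Prop :=
  nested u /\ forall i, y i = vert s (u i).

(** For a flag the union is its largest member, so this composes the last-vertex maps of both
    subdivisions. *)
Definition lastv k (F : {set {set 'I_k.+1}}) : 'I_k.+1 := maxi (finset.cover F).

Lemma lastv_gimg m n (h : 'I_m.+1 -> 'I_n.+1) F :
  incr h -> flag F -> lastv (gimg h F) = h (lastv F).
Proof.
by move=> hi /flag_cover_neq0 F0; rewrite /lastv cover_gimg maxi_incr.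
Qed.

Lemma nested_max k r (u : oseq {set {set 'I_k.+1}} r) i :
  nested u -> u i \subset u ord_max.
Proof.
move=> [_ u_mono]; have := leq_ord i; rewrite leq_eqVlt => /orP[/eqP iE|]; last exact: (u_mono i ord_max).
by have -> : i = ord_max by exact: val_inj.
Qed.

(* Only the last vertex of [y] matters: the other ones are faces of it. *)
Lemma represents_last k (s : singularSimplex R Y k) r u (y : oseq (cell R Y) r) :
  represents s u y ->
  exists w, [/\ represents (csimp (y ord_max)) w y,
    forall i, w i \subset cflag (y ord_max), flag (cflag (y ord_max)) &
    nsimp G (csimp (y ord_max)) (oseq_map (@lastv _) w)
    = nsimp G s (oseq_map (@lastv _) u)].
Proof.
move=> [u_nested yE]; have [u_flag u_mono] := u_nested.
have := yE ord_max; case E : (y ord_max) => [j [t C]] vE.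
have [g [/= gi tE Cc CF]] := vertP s (flag_cover_neq0 (u_flag ord_max)).
rewrite -vE /csimp /cflag /= in g gi tE Cc CF *.
(* The flags are pulled back to the face carried by the last vertex, where each of them becomes a
   part of [C]. *)
pose w : oseq {set {set 'I_j.+1}} r := [ffun i => [set S in C | g @: S \in u i]%SET].
have gw i : gimg g (w i) = u i.
  rewrite ffunE; apply/setP => S; apply/imsetP/idP => [[S' + ->]|Su].
    by rewrite inE => /andP[].
  have : S \in gimg g C by rewrite CF (fintype.subsetP (nested_max i u_nested)).
  by move=> /imsetP[S' S'C SE]; exists S'; rewrite // inE S'C -SE.
have w_flag i : flag (w i) by apply/(flag_gimgE _ gi); rewrite gw.
have gi' := incr_inj gi.
exists w; split.
- split; first split=> // i l il.
    apply/fintype.subsetP => S; rewrite !ffunE !inE => /andP[-> /=].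
    exact/fintype.subsetP/u_mono.
  by move=> i; rewrite tE vert_gimg ?gw //; exact: flag_cover_neq0.
- by move=> i; apply/fintype.subsetP => S; rewrite ffunE inE => /andP[].
- by apply/(flag_gimgE _ gi); rewrite CF.
- rewrite tE nsimp_pull //; congr (nsimp _ _ _); apply/ffunP => i.
  by rewrite [RHS]ffunE oseq_map_comp [LHS]ffunE /= -(lastv_gimg gi (w_flag i)) gw.
Qed.

(* The image of [y] under the last-vertex map; by [lvchainE] it does not depend on the
   singular simplex in which the flags are represented. *)
Definition lvchain r (y : oseq (cell R Y) r) : {malg G[singularSimplex R Y r]} :=
  xget 0 [set c | exists k (s : singularSimplex R Y k) u,
    represents s u y /\ c = nsimp G s (oseq_map (@lastv _) u)].

(** Both unions are members of the flag [C], hence comparable, and the common vertex records their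
    cardinality. Here the second subdivision pays off: inside a flag, size determines the face. *)
Lemma vert_cover j (t : singularSimplex R Y j) (C F F' : {set {set 'I_j.+1}}) :
  flag C -> flag F -> flag F' -> F \subset C -> F' \subset C ->
  vert t F = vert t F' -> finset.cover F = finset.cover F'.
Proof.
move=> [_ _ C_chain] F_flag F'_flag FC F'C.
have [g [/incr_inj gi _ gc gF]] := vertP t (flag_cover_neq0 F_flag).
have [g' [/incr_inj gi' _ gc' gF']] := vertP t (flag_cover_neq0 F'_flag).
move=> vE; have card_eq : #|finset.cover F| = #|finset.cover F'|.
  rewrite -gF -gF' !cover_gimg gc gc' !card_imset // !cardsT !card_ord.
  by rewrite vE.
have := C_chain _ _ (fintype.subsetP FC _ (flag_cover F_flag))
                    (fintype.subsetP F'C _ (flag_cover F'_flag)).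
by move=> /orP[] FF'; [|apply/esym]; apply/eqP; rewrite finset.eqEcard FF' card_eq /=.
Qed.

(** Two representations are both transported to the last vertex of [y], where [vert_cover]
    identifies the last vertices of their flags. *)
Lemma lvchainE k (s : singularSimplex R Y k) r u (y : oseq (cell R Y) r) :
  represents s u y -> lvchain y = nsimp G s (oseq_map (@lastv _) u).
Proof.
move=> suy; rewrite /lvchain; case: xgetP => [c -> [k' [s' [u' [s'u'y ->]]]]|].
  have [w [[[w_flag _] wy] wC Cflag <-]] := represents_last suy.
  have [w' [[[w'_flag _] w'y] w'C _ <-]] := represents_last s'u'y.
  congr (nsimp _ _ _); apply/ffunP => i; rewrite !ffunE /lastv.
  congr maxi; apply: esym; apply: (vert_cover (t := csimp (y ord_max)) Cflag (w_flag i) (w'_flag i) (wC i) (w'C i)).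
  by rewrite -wy -w'y.
by move=> /(_ (nsimp G s (oseq_map (@lastv _) u))) []; exists k, s, u.
Qed.

Lemma lvchain_supp r (y : oseq (cell R Y) r) :
  supp_in (fun t => exists2 h, incr h & t = sing_pull h (csimp (y ord_max))) (lvchain y).
Proof.
rewrite /lvchain; case: xgetP => [c _ [k [s [u [/represents_last[w [_ _ _ <-]] ->]]]]|_].
  rewrite /nsimp; case: asboolP => [Mi|_]; last exact: supp_in0.
  by apply: supp_inU; eexists; first exact: Mi.
exact: supp_in0.
Qed.

Definition ident k : oseq 'I_k.+1 k := [ffun a => a].

Definition alphaU k (s : singularSimplex R Y k) : {malg G[oseq (cell R Y) k]} :=
  opush (vert s) (sd (sd << ident k >>)).

Lemma ident_inj k : injective (ident k).
Proof. by move=> a b; rewrite !ffunE. Qed.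

(** Vertices of the second subdivision are nonempty sets of members of a flag [y], and such a set is
    again a flag. *)
Lemma sdsd_supp k r (x : oseq 'I_k.+1 r) : injective x ->
  supp_in (fun u => nested u /\ forall i j : 'I_r.+1, (i < j)%N -> u i \proper u j)
    (sd (sd << x >> : {malg G[oseq _ r]})).
Proof.
move=> x_inj; apply: (supp_in_linext (sd_flag x_inj)) => y xy.
rewrite -sd_gen => u; move/(sd_flag (flag_of_inj xy)) => yu.
have [u_incr u_neq0 _] := yu; have [_ y_neq0 _] := xy.
split; last exact: u_incr.
split=> [i|i j ij]; last exact/fintype.proper_sub/u_incr.
have uy S : S \in u i -> exists a, S = y a.
  by move/(fintype.subsetP (flag_of_im i yu)) => /imsetP[a _ ->]; exists a.
split=> //.
  by apply/negP => /uy[a /esym/eqP]; apply/negP; exact: y_neq0.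
move=> _ _ /uy[a ->] /uy[b ->].
by case: (leqP a b) => [|/ltnW] /(flag_of_sub xy) ->; rewrite ?orbT.
Qed.

(** Naturality of [sd] writes the subdivided face as an image under [lift i], and [vert_gimg] reads
    it as the subdivision of [sing_face i s]. *)
Lemma alphaU_bnd k (s : singularSimplex R Y k.+1) :
  obnd (alphaU s) = \sum_(i < k.+2) (-1) ^+ i *: alphaU (sing_face i s).
Proof.
pose h := @opush G _ _ (vert s) k \o @sd G _ k \o @sd G _ k : {linear _ -> _}.
rewrite /alphaU opush_bnd !sd_bnd obndU -[LHS]/(h _) linear_sum.
apply: eq_bigr => i _; rewrite linearZ; congr (_ *: _); rewrite /h /=.
have -> : oface i (ident k.+1) = oseq_map (lift i) (ident k).
  by apply/ffunP => a; rewrite !ffunE.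
rewrite -opushU -!opush_sd opush_comp.
apply: (eq_opush_in (sdsd_supp (@ident_inj k))) => u [[u_flag _] _] a.
rewrite /= -vert_gimg //; first exact: incr_lift.
exact: flag_cover_neq0.
Qed.

Definition alpha k : {malg G[singularSimplex R Y k]} -> {malg G[oseq (cell R Y) k]} :=
  linext (@alphaU k).
HB.instance Definition _ k := GRing.Linear.on (@alpha k).

Lemma alpha_gen k (s : singularSimplex R Y k) : alpha << s >> = alphaU s.
Proof. exact: linextU. Qed.

Lemma alpha_bnd k (c : {malg G[singularSimplex R Y k.+1]}) :
  obnd (alpha c) = alpha (bnd (singular R G Y) k c).
Proof.
apply: (linextP (f := @obnd _ _ _ \o @alpha _) (g := @alpha _ \o bnd (singular R G Y) k)).
move=> s /=; rewrite alpha_gen alphaU_bnd alt_bndU linear_sum.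
by apply: eq_bigr => i _; rewrite linearZ /= alpha_gen.
Qed.

Lemma nsimp_subdivision k (s : singularSimplex R Y k) :
  linext (fun u => nsimp G s (oseq_map (@lastv _) u)) (sd (sd << ident k >>)) = << s >>.
Proof.
pose N : {linear {malg G[oseq 'I_k.+1 k]} -> _} := linext (@nsimp R G Y k s k).
have N0 (y : oseq 'I_k.+1 k) (a b : 'I_k.+1) :
    b = a.+1 :> nat -> y a = y b -> N << y >> = 0.
  move=> ab yab; rewrite /N /= linextU; apply: (@nsimp_repeat _ _ _ _ _ _ _ a b) => //.
  by rewrite -val_eqE /= ab neq_ltn ltnSn.
transitivity (N (opush (@lastv _) (sd (sd << ident k >>)))).
  by rewrite /opush [RHS]linear_linext; apply: eq_linext => u; rewrite /N /= linextU.
(* The outer subdivision collapses over each flag [y] separately; the inner one is left for the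
   end. *)
transitivity (N (opush (@maxi _) (sd << ident k >>))).
  apply: (eq_linear_in (h := N \o @opush _ _ _ (@lastv _) _ \o @sd _ _ _)
    (h' := N \o @opush _ _ _ (@maxi _) _) (sd_flag (@ident_inj k))) => y yflag /=.
  rewrite [in RHS]opushU; apply: sd_last_vertex => //.
    exact: flag_of_inj yflag.
  move=> S a Sy ya ymax; rewrite ffunE /lastv; congr maxi.
  apply/eqP; rewrite finset.eqEsubset; apply/andP; split; last first.
    exact: (finset.bigcup_sup (y a)).
  apply/finset.bigcupsP => T TS; have /imsetP[b _ Tb] := fintype.subsetP Sy _ TS.
  by rewrite Tb; apply: (flag_of_sub yflag); apply: ymax; rewrite -Tb.
rewrite (sd_last_vertex (z := ident k)) ?/N /= ?linextU ?nsimp_id //.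
  exact: ident_inj.
move=> S a _; rewrite !ffunE => aS amax; apply: maxiE => // b bS.
by apply: amax; rewrite ffunE.
Qed.

End CellSequences.

(** * Oriented chains, carriers and star refinements *)

Section Sorting.

Lemma sort_perm n (r : 'I_n.+1 -> nat) : injective r ->
  exists p : 'S_n.+1, forall a b : 'I_n.+1, (a < b)%N -> (r (p a) < r (p b))%N.
Proof.
move=> r_inj; pose m := \max_a r a.
have rm a : (r a < m.+1)%N by rewrite ltnS /m leq_bigmax.
pose r' a := Ordinal (rm a); have r'_inj : injective r' by move=> a b [/r_inj].
have W0 : r' @: [set: 'I_n.+1]%SET != finset.set0.
  by apply/finset.set0Pn; exists (r' ord0); apply: imset_f; rewrite inE.
have [l [g [gi gW]]] := incr_onto W0.
have ln : l = n.
  have := congr1 (fun S : {set _} => #|S|) gW.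
  by rewrite !card_imset ?cardsT ?card_ord; [case|exact: r'_inj|exact: incr_inj].
subst l.
have gr a : exists b, r' b == g a.
  have : g a \in g @: [set: 'I_n.+1]%SET by apply: imset_f; rewrite inE.
  by rewrite gW => /imsetP[b _ ->]; exists b.
pose f a := xchoose (gr a); have fE a : r' (f a) = g a := eqP (xchooseP (gr a)).
have f_inj : injective f by move=> a b fab; apply: (incr_inj gi); rewrite -!fE fab.
exists (perm f_inj) => a b /gi; rewrite !permE -!fE; exact.
Qed.

End Sorting.

(** * Maps on oriented chains defined by a ranked ordering *)

Section Antisymmetrization.
Variables (G : comNzRingType) (V : choiceType) (K : simplicialComplex V).
Variable rank : V -> nat.

Definition ranked k (y : oseq V k) : Prop :=
  forall a b : 'I_k.+1, (a < b)%N -> (rank (y a) < rank (y b))%N.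

Variables (M : lmodType G) (k : nat) (g : oseq V k -> M).

(** At most one ordering of a simplex is ranked, so the sum has at most one nonzero term; summing
    over all permutations makes compatibility with [orient_rel] a mere reindexing. *)
Definition antisym_pre : {malg G[orderedSimplex K k]} -> M :=
  linext (fun s => \sum_(p : 'S_k.+1)
    (-1) ^+ p *: (if `[< ranked (ord_perm p s) >] then g (ord_perm p s) else 0)).
HB.instance Definition _ := GRing.Linear.on antisym_pre.

Lemma ord_permM (p q : 'S_k.+1) (s : orderedSimplex K k) :
  ord_perm q (ord_perm p s) = ord_perm (q * p)%g s.
Proof. by apply/val_inj/ffunP => a; rewrite !ffunE permM. Qed.

Lemma antisym_rel c : orient_rel c -> antisym_pre c = 0.
Proof.
move=> [p [s ->]]; apply/eqP; rewrite linearB subr_eq0 linearZ /=; apply/eqP.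
rewrite /antisym_pre !linextU [RHS]scaler_sumr.
rewrite [RHS](reindex_inj (mulIg p)); apply: eq_bigr => q _.
rewrite ord_permM scalerA; congr (_ *: _).
by rewrite odd_permM signr_addb mulrCA -expr2 sqrr_sign mulr1.
Qed.

Definition antisym : oriented G K k -> M := qlift antisym_rel.
HB.instance Definition _ := GRing.Linear.on antisym.

Lemma antisymE (s : orderedSimplex K k) : antisym (ochain G s) =
  \sum_(p : 'S_k.+1)
    (-1) ^+ p *: (if `[< ranked (ord_perm p s) >] then g (ord_perm p s) else 0).
Proof. by rewrite /antisym /ochain qlift_pi /= /antisym_pre linextU. Qed.

Lemma ord_perm1 (s : orderedSimplex K k) : ord_perm 1 s = s.
Proof. by apply/val_inj/ffunP => a; rewrite !ffunE perm1. Qed.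

Lemma ranked_perm (s : orderedSimplex K k) (p : 'S_k.+1) :
  ranked s -> ranked (ord_perm p s) -> p = 1%g.
Proof.
move=> sr spr; have p_incr : incr p.
  move=> a b ab; have := spr _ _ ab; rewrite !ffunE.
  by case: (ltngtP (p a) (p b)) => // [/sr/ltnW|/val_inj ->]; rewrite leqNgt ?ltnn => /negP.
apply/permP => a; rewrite perm1.
have -> : (p : _ -> _) = id; last by [].
apply: incr_im_inj => //; apply/setP => b.
transitivity true; last by apply/esym/imsetP; exists b; rewrite ?inE.
by apply/imsetP; exists (p^-1 b)%g; rewrite ?inE // permKV.
Qed.

Lemma antisym_ranked (s : orderedSimplex K k) :
  ranked s -> antisym (ochain G s) = g s.
Proof.
move=> sr; rewrite antisymE (bigD1 1%g) // big1 => [|p p1].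
  rewrite [LHS]addr0 ord_perm1.
  by rewrite asboolT // odd_perm1 expr0 scale1r.
by rewrite asboolF ?scaler0 // => /(ranked_perm sr) pE; rewrite pE eqxx in p1.
Qed.

Lemma ranked_exists (s : orderedSimplex K k) :
  (forall v w, v \in vset s -> w \in vset s -> rank v = rank w -> v = w) ->
  exists p : 'S_k.+1, ranked (ord_perm p s).
Proof.
move=> rank_inj; have [|p pr] := @sort_perm k (fun a => rank (s a)).
  move=> a b; move/rank_inj; case: s {rank_inj} => /= s /andP[/injectiveP s_inj _].
  by move=> h; apply/s_inj/h; apply/imfsetP; eexists.
by exists p => a b /pr; rewrite !ffunE.
Qed.

End Antisymmetrization.

Lemma ochain_permE (G : comNzRingType) (V : choiceType) (K : simplicialComplex V) k
    (p : 'S_k.+1) (s : orderedSimplex K k) :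
  ochain G s = (-1) ^+ p *: ochain G (ord_perm p s).
Proof. by rewrite ochain_perm scalerA -expr2 sqrr_sign scale1r. Qed.

Section Realize.
Variables (G : comNzRingType) (V : choiceType) (K : simplicialComplex V).

Definition osimp k (y : oseq V k) : bool := injectiveb y && `[< simplices K (vset y) >].

Definition toOriented k : {malg G[oseq V k]} -> oriented G K k :=
  linext (fun y => oapp (fun s : orderedSimplex K k => ochain G s) 0 (insub y)).
HB.instance Definition _ k := GRing.Linear.on (@toOriented k).

Lemma toOrientedU k (s : orderedSimplex K k) :
  toOriented << (overtex s : oseq V k) >> = ochain G s.
Proof. by rewrite /toOriented linextU valK. Qed.

(** [toOriented] sends sequences that repeat a vertex or leave [K] to 0, so boundaries are compared
    on chains of genuine simplices. *)
Lemma toOriented_bnd k (c : {malg G[oseq V k.+1]}) :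
  supp_in (@osimp k.+1) c ->
  bnd (oriented G K) k (toOriented c) = toOriented (obnd c).
Proof.
move=> Kc; apply: (eq_linear_in (h := bnd (oriented G K) k \o @toOriented k.+1)
  (h' := @toOriented k \o @obnd _ _ _) Kc) => y Ky /=.
pose s : orderedSimplex K k.+1 := OrderedSimplex Ky.
rewrite -[y]/(overtex s) toOrientedU bnd_ochain obndU linear_sum.
by apply: eq_bigr => i _; rewrite linearZ /= -toOrientedU.
Qed.

End Realize.

Section CarrierLemmas.
Variables (R : realType) (G : comNzRingType) (X : topologicalType).

Lemma carrier_subP k (c : singular R G X k) (B : set X) :
  carrier c `<=` B <-> supp_in (fun s : singularSimplex R X k => range s `<=` B) c.
Proof.
split=> [cB s sc x sx|cB x [s /= sc sx]]; last exact: cB sc _ sx.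
by apply: cB; exists s.
Qed.

Lemma carrier_subD k (c d : singular R G X k) (B : set X) :
  carrier c `<=` B -> carrier d `<=` B -> carrier (c + d) `<=` B.
Proof. by rewrite !carrier_subP; exact: supp_inD. Qed.

Lemma carrier_subZ k a (c : singular R G X k) (B : set X) :
  carrier c `<=` B -> carrier (a *: c) `<=` B.
Proof. by rewrite !carrier_subP; exact: supp_inZ. Qed.

Lemma carrier_sub0 k (B : set X) : carrier (0 : singular R G X k) `<=` B.
Proof. by rewrite carrier_subP; exact: supp_in0. Qed.

Lemma carrier_sub_sum k (I : Type) (r : seq I) (P : pred I)
    (F : I -> singular R G X k) (B : set X) :
  (forall i, P i -> carrier (F i) `<=` B) -> carrier (\sum_(i <- r | P i) F i) `<=` B.
Proof.
move=> FB; rewrite carrier_subP; apply: supp_in_sum => i /FB.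
by rewrite carrier_subP.
Qed.

Lemma carrier_sub_linear (T : choiceType) k (h : {linear {malg G[T]} -> singular R G X k})
    (Q : T -> Prop) c (B : set X) :
  supp_in Q c -> (forall x, Q x -> carrier (h << x >>) `<=` B) -> carrier (h c) `<=` B.
Proof.
move=> Qc QB; rewrite linear_linextE carrier_subP.
by apply: (supp_in_linext Qc) => x /QB; rewrite carrier_subP.
Qed.

Lemma simplex_inhabited k : exists t : Simplex R k, True.
Proof.
pose t : 'rV[R]_k.+1 := \row_i (i == ord0)%:R.
suff st : @std_simplex R k t by exists (SigSub (mem_set st)).
split=> [i|]; first by rewrite mxE ler0n.
rewrite (bigD1 ord0) //= mxE eqxx big1 ?addr0 // => i /negbTE i0.
by rewrite mxE i0.
Qed.

(** The coefficient 1 is nonzero in [G] and the standard simplex is nonempty. This provides the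
    common points that make members of a cover meet. *)
Lemma carrier_schain_neq0 k (s : singularSimplex R X k) : carrier (schain G s) !=set0.
Proof.
have [t _] := simplex_inhabited k; exists (s t); exists s; last by exists t.
by rewrite /= /schain -mcoeff_neq0 mcoeffUU oner_neq0.
Qed.

End CarrierLemmas.

(** * Star refinements of open covers of a metric space *)

Section StarRefinement.
Variables (R : realType) (X : metricType R).

Definition star (W : set (set X)) (B : set X) : set X :=
  \bigcup_(C in [set C | W C /\ C `&` B !=set0]) C.

Definition star_refines (W V : set (set X)) : Prop :=
  forall B, W B -> exists2 A, V A & star W B `<=` A.

Variable V : set (set X).
Hypothesis V_cover : open_cover V.

Let fits x n := `[< exists2 A, V A & ball x (n.+1%:R^-1 : R) `<=` A >].

Let fits_exists x : exists n, fits x n.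
Proof.
have [V_open /(_ x)[A VA Ax]] := V_cover.
have /nbhs_ballP[e /= e0 eA] : nbhs x A by apply: open_nbhs_nbhs; split=> //; exact: V_open.
exists (Num.truncn e^-1); apply/asboolP; exists A => //.
apply: subset_trans eA; apply: le_ball.
by rewrite -[leRHS]invrK lef_pV2 ?posrE ?invr_gt0 ?ltr0n // ltW // truncnS_gt.
Qed.

(* Up to a factor 2, the largest radius of a ball around [x] contained in some
   member of [V]. *)
Let radius x : R := (ex_minn (fits_exists x)).+1%:R^-1.

Let radius_gt0 x : 0 < radius x.
Proof. by rewrite invr_gt0 ltr0n. Qed.

Let radius_fits x : exists2 A, V A & ball x (radius x) `<=` A.
Proof. by rewrite /radius; case: ex_minnP => n /asboolP. Qed.

(** The ball around [y] of half the radius at [x] lies in the ball around [x], hence in a member of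
    [V]. *)
Let radius_half x y : ball x (radius x / 2) y -> radius x <= 2 * radius y.
Proof.
have [A VA xA] := radius_fits x; move: xA; rewrite /radius.
case: ex_minnP => n _ _; case: ex_minnP => m _ mmin xA xy.
(* The index 2n+1 stands for the radius 1/(2n+2), half of 1/(n+1). *)
have /mmin mn : fits y (n.*2.+1).
  apply/asboolP; exists A => //; apply: subset_trans xA => z yz.
  rewrite [_^-1]splitr; apply: ball_triangle xy _.
  by rewrite -invfM -natrM muln2.
rewrite ler_pdivlMr ?ltr0n // ler_pdivrMl ?ltr0n // -natrM ler_nat.
by rewrite muln2 doubleS ltnS (leq_trans mn).
Qed.

Lemma star_refinement : exists W, [/\ open_cover W, refines W V & star_refines W V].
Proof.
(* With 8, the centers of two members that meet are closer than half the larger radius, so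
   [radius y <= 2 * radius x]; points of the second member are then within 1/8 + 2/8 + 2/8 of the
   radius at [x]. Interiors make the members open. *)
pose N x := (ball x (radius x / 8))^°.
have N_ball x : N x `<=` ball x (radius x / 8) by exact: interior_subset.
pose W := [set N x | x in [set: X]].
have W_star : star_refines W V.
  move=> _ [x _ <-]; have [A VA xA] := radius_fits x; exists A => //.
  apply: subset_trans xA => z [_ [[y _ <-] [w [yw xw]]] yz].
  have {}yw := N_ball _ _ yw; have {}xw := N_ball _ _ xw; have {}yz := N_ball _ _ yz.
  have xy : ball x (radius x / 8 + radius y / 8) y.
    exact: ball_triangle xw (ball_sym yw).
  have yx : radius y <= 2 * radius x.
    have [xley|/ltW yltx] := leP (radius x) (radius y).
      apply: radius_half; apply: ball_sym; apply: le_ball xy.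
      by have := radius_gt0 y; lra.
    by apply: le_trans yltx _; have := radius_gt0 x; lra.
  apply: le_ball (ball_triangle xy yz).
  by have := radius_gt0 x; have := radius_gt0 y; lra.
have W_open : open_cover W.
  split=> [_ [x _ <-]|x]; first exact: open_interior.
  by exists (N x); [exists x | apply: nbhsx_ballx; rewrite divr_gt0].
exists W; split=> // _ [x _ <-].
have [A VA WA] := W_star _ (ex_intro2 _ _ x I erefl); exists A => //.
apply: subset_trans WA => z xz; exists (N x) => //; split; first by exists x.
by exists z.
Qed.

End StarRefinement.

(** * The partial realization *)

Section Formula.
Variables (R : realType) (G : comNzRingType) (Y X : topologicalType) (A : set Y).
Variables phi psi : chainMorphism (singular R G Y) (singular R G X).
Variable D : chainHomotopy (cmor_comp phi (singular_incl R G A))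
                           (cmor_comp psi (singular_incl R G A)).

Definition push_sub k (a : singularSimplex R (set_type A) k) : singularSimplex R Y k :=
  sing_push (set_val : continuousType (set_type A) Y) a.

Definition in_sub k (s : singularSimplex R Y k) : Prop := exists a, s = push_sub a.

Lemma in_sub_pull j k (h : 'I_j.+1 -> 'I_k.+1) (s : singularSimplex R Y k) :
  in_sub s -> in_sub (sing_pull h s).
Proof. by move=> [a ->]; exists (sing_pull h a); exact/continuousEP. Qed.

Lemma push_sub_inj k : injective (@push_sub k).
Proof.
move=> a b /continuousEP ab; apply/continuousEP => t.
by apply: val_inj; exact: ab.
Qed.

Lemma singular_incl_gen k (a : singularSimplex R (set_type A) k) :
  singular_incl R G A k (schain G a) = schain G (push_sub a).
Proof. exact: (linextU (fun s => << push_sub s >>)). Qed.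

(** [D] is extended by 0 off [A]; the homotopy identity is kept on chains supported in [A]. *)
Definition subhom k : {malg G[singularSimplex R Y k]} -> singular R G X k.+1 :=
  linext (fun s => if pselect (in_sub s) is left sA
                   then D k (schain G (projT1 (cid sA))) else 0).
HB.instance Definition _ k := GRing.Linear.on (@subhom k).

Lemma subhom_push k (a : singularSimplex R (set_type A) k) :
  subhom << push_sub a >> = D k (schain G a).
Proof.
rewrite /subhom linextU; case: pselect => [sA|]; last by case; exists a.
by case: cid => b /= /push_sub_inj ->.
Qed.

Lemma subhom_incl k (c : singular R G (set_type A) k) :
  subhom (singular_incl R G A k c) = D k c.
Proof.
apply: (linextP (f := @subhom k \o singular_incl R G A k) (g := D k)) => a /=.
by rewrite -[<< a >>]/(schain G a) singular_incl_gen subhom_push.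
Qed.

Lemma subhom_bnd0 (s : singularSimplex R Y 0) : in_sub s ->
  bnd (singular R G X) 0 (subhom << s >>) = phi 0 << s >> - psi 0 << s >>.
Proof. by move=> [a ->]; rewrite subhom_push hmap0 /= singular_incl_gen. Qed.

Lemma subhom_bndS k (s : singularSimplex R Y k.+1) : in_sub s ->
  bnd (singular R G X) k.+1 (subhom << s >>)
  = phi k.+1 << s >> - psi k.+1 << s >> - subhom (bnd (singular R G Y) k << s >>).
Proof.
move=> [a ->]; rewrite subhom_push hmapS /= singular_incl_gen.
by rewrite -subhom_incl -cmor_bnd singular_incl_gen.
Qed.

Local Notation cells r := (oseq (cell R Y) r).
Local Notation lcells r := (oseq (cell R Y * bool)%type r).

Definition base r (y : lcells r) : cells r := oseq_map fst y.

(** The part of the Alexander-Whitney map with an edge in the interval direction: the front face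
    lies at the bottom and the last edge climbs. The sign is that of such a simplex in the prism. *)
Definition climb r : lcells r -> singular R G X r :=
  match r with
  | 0 => fun=> 0
  | r'.+1 => fun y => if (ofront y ord_max).2 then 0
                      else (-1) ^+ r' *: subhom (lvchain G (base (ofront y)))
  end.

(* The homotopy, extended over the ordered simplices of the prism by composing with the
   Alexander-Whitney map from the triangulated prism to its cells. *)
Definition realval r (y : lcells r) : singular R G X r :=
  if (y ord_max).2 then phi r (lvchain G (base y)) + climb y
  else psi r (lvchain G (base y)).

Definition admissible r (y : lcells r) : Prop :=
  exists k (s : singularSimplex R Y k) u,
  [/\ represents s u (base y),
      forall a b : 'I_r.+1, (a < b)%N -> (y a).2 ==> (y b).2 &
      in_sub s \/ forall a b, (y a).2 = (y b).2].

Lemma base_face r i (y : lcells r.+1) : base (oface i y) = oface i (base y).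
Proof. by apply/ffunP => a; rewrite !ffunE. Qed.

Lemma lift_ltn r (i : 'I_r.+2) (a b : 'I_r.+1) : (a < b)%N -> (lift i a < lift i b)%N.
Proof. exact: incr_lift. Qed.

Lemma represents_face k (s : singularSimplex R Y k) r u (y : cells r.+1) i :
  represents s u y -> represents s (oface i u) (oface i y).
Proof.
move=> [[u_flag u_mono] yE]; split; first split=> [a|a b ab].
- by rewrite ffunE.
- by rewrite !ffunE; exact/u_mono/lift_ltn.
- by move=> a; rewrite !ffunE.
Qed.

Lemma lvchain_bnd k (s : singularSimplex R Y k) r u (y : cells r.+1) :
  represents s u y ->
  bnd (singular R G Y) r (lvchain G y) = \sum_(i < r.+2) (-1) ^+ i *: lvchain G (oface i y).
Proof.
move=> suy; have [[u_flag u_mono] _] := suy.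
rewrite (lvchainE G suy) nsimp_bnd.
  apply: eq_bigr => i _; rewrite (lvchainE G (represents_face i suy)).
  by congr (_ *: nsimp _ _ _); apply/ffunP => a; rewrite !ffunE.
move=> a b ab; rewrite !ffunE; apply: maxi_mono; first exact: (flag_cover_neq0 (u_flag a)).
apply/finset.bigcupsP => S Sa; apply: (finset.bigcup_sup S) => //.
exact: (fintype.subsetP (u_mono _ _ ab)).
Qed.

Lemma lvchain_repeat r (y : cells r) (a b : 'I_r.+1) : a != b -> y a = y b -> lvchain G y = 0.
Proof.
move=> ab yab; rewrite /lvchain; case: xgetP => // c _ [k [s [u [[u_nested yE] ->]]]].
apply: (@nsimp_repeat _ _ _ _ _ _ _ a b) => //; rewrite !ffunE /lastv; congr maxi.
have [u_flag _] := u_nested.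
apply: (vert_cover (t := s) (u_flag ord_max) (u_flag a) (u_flag b)).
- exact: nested_max.
- exact: nested_max.
- by rewrite -!yE.
Qed.

Lemma lvchain_in_sub k (s : singularSimplex R Y k) r u (y : cells r) :
  represents s u y -> in_sub s -> supp_in (@in_sub r) (lvchain G y).
Proof.
move=> suy sA; rewrite (lvchainE G suy) /nsimp; case: asboolP => _.
  by apply: supp_inU; exact: in_sub_pull.
exact: supp_in0.
Qed.

Lemma subhom_bnd0_in c : supp_in (@in_sub 0) c ->
  bnd (singular R G X) 0 (subhom c) = phi 0 c - psi 0 c.
Proof.
move=> cA; apply: (eq_linear_in (h := bnd (singular R G X) 0 \o @subhom 0)
  (h' := phi 0 \- psi 0) cA) => s; exact: subhom_bnd0.
Qed.

Lemma subhom_bndS_in k c : supp_in (@in_sub k.+1) c ->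
  bnd (singular R G X) k.+1 (subhom c)
  = phi k.+1 c - psi k.+1 c - subhom (bnd (singular R G Y) k c).
Proof.
move=> cA; apply: (eq_linear_in (h := bnd (singular R G X) k.+1 \o @subhom k.+1)
  (h' := phi k.+1 \- psi k.+1 \- (@subhom k \o bnd (singular R G Y) k)) cA) => s.
exact: subhom_bndS.
Qed.

Lemma alt_sum_lift_max (M : lmodType G) k (F : 'I_k.+2 -> M) :
  \sum_(i < k.+2) (-1) ^+ i *: F i
  = \sum_(i < k.+1) (-1) ^+ i *: F (lift ord_max i) + (-1) ^+ k.+1 *: F ord_max.
Proof.
rewrite big_ord_lift_max.
by under eq_bigr => i _ do rewrite lift_max.
Qed.

Lemma morph_lvchain (chi : chainMorphism (singular R G Y) (singular R G X)) k
    (s : singularSimplex R Y k) r u (y : lcells r.+1) :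
  represents s u (base y) ->
  bnd (singular R G X) r (chi r.+1 (lvchain G (base y)))
  = \sum_(i < r.+1) (-1) ^+ i *: chi r (lvchain G (base (oface (lift ord_max i) y)))
    + (-1) ^+ r.+1 *: chi r (lvchain G (base (ofront y))).
Proof.
move=> suy; rewrite cmor_bnd (lvchain_bnd suy) linear_sum -(alt_sum_lift_max
  (fun i => chi r (lvchain G (base (oface i y))))).
by apply: eq_bigr => i _; rewrite linearZ base_face.
Qed.

Lemma climbS r (y : lcells r.+1) :
  climb y = if (ofront y ord_max).2 then 0
            else (-1) ^+ r *: subhom (lvchain G (base (ofront y))).
Proof. by []. Qed.

Lemma climb_face r (y : lcells r.+2) (i : 'I_r.+2) :
  climb (oface (lift ord_max i) y)
  = if (oface i (ofront y) ord_max).2 then 0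
    else (-1) ^+ r *: subhom (lvchain G (base (oface i (ofront y)))).
Proof. by rewrite climbS ofront_face. Qed.

(** Only two faces can climb, those omitting one of the last two vertices; they have the same front
    and opposite signs. *)
Lemma climb_bnd_true r (y : lcells r.+1) : (ofront y ord_max).2 ->
  \sum_(i < r.+1) (-1) ^+ i *: climb (oface (lift ord_max i) y)
  + (-1) ^+ r.+1 *: climb (ofront y) = 0.
Proof.
case: r y => [|r] y ymax; first by rewrite big1 ?add0r ?scaler0 // => i _; rewrite scaler0.
rewrite big_ord_lift_max big1 => [|i _].
  rewrite add0r climb_face -/(ofront (ofront y)) -climbS.
  have -> : nat_of_ord (@ord_max r.+1) = r.+1 by [].
  by rewrite [X in _ + X *: _]exprS mulN1r scaleNr subrr.
by rewrite climb_face oface_max ymax scaler0.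
Qed.

Lemma ofrontE r (y : lcells r.+1) a : ofront y a = y (lift ord_max a).
Proof. exact: ffunE. Qed.

(** This is the homotopy identity of [D] on the front face, which lies at the bottom; the boundary
    of that face accounts for the other faces of [y]. *)
Lemma climb_bnd_false r (y : lcells r.+1) : admissible y -> (y ord_max).2 ->
  ~~ (ofront y ord_max).2 ->
  bnd (singular R G X) r (climb y) + (-1) ^+ r.+1 *: phi r (lvchain G (base (ofront y)))
  = \sum_(i < r.+1) (-1) ^+ i *: climb (oface (lift ord_max i) y)
    + (-1) ^+ r.+1 *: psi r (lvchain G (base (ofront y))).
Proof.
move=> [k [s [u [suy y_mono yA]]]] ymax /negbTE fmax.
(* Both levels occur, so admissibility puts [s] in [A]. *)
have sA : in_sub s.
  case: yA => // /(_ (lift ord_max ord_max) ord_max) yc.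
  by move: fmax; rewrite ffunE yc ymax.
have fE a : (ofront y a).2 = false.
  have := leq_ord a; rewrite leq_eqVlt => /orP[/eqP aE|am].
    by have -> : a = ord_max by exact: val_inj.
  have := y_mono (lift ord_max a) (lift (@ord_max r.+1) (@ord_max r)).
  by rewrite !lift_max => /(_ am); rewrite -!ofrontE fmax implybF => /negbTE.
have sfu : represents s (oface ord_max u) (base (ofront y)).
  by rewrite base_face; exact: represents_face.
have fA := lvchain_in_sub sfu sA.
rewrite climbS fmax linearZ /=.
case: r y u {suy y_mono yA ymax fmax} fE sfu fA => [|r] y u fE sfu fA.
  rewrite (subhom_bnd0_in fA) big1 ?add0r => [|i _]; last by rewrite scaler0.
  by rewrite expr0 scale1r expr1 !scaleN1r addrAC subrr add0r.
rewrite (subhom_bndS_in fA) (lvchain_bnd sfu).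
set S := subhom _; rewrite (_ : \sum_(i < r.+2) _ = (-1) ^+ r *: S); last first.
  rewrite /S [subhom _]linear_sum scaler_sumr; apply: eq_bigr => i _.
  rewrite climb_face [(oface _ _ _).2](_ : _ = false); last by rewrite ffunE fE.
  by rewrite base_face /= [subhom (_ *: _)]linearZ /= !scalerA mulrC.
rewrite !exprS !mulN1r opprK !scaleNr -scalerN -!scalerDr; congr (_ *: _).
by rewrite !opprB addrA subrK.
Qed.

Lemma realval_false r (y : lcells r) :
  (y ord_max).2 = false -> realval y = psi r (lvchain G (base y)).
Proof. by rewrite /realval => ->. Qed.

Lemma realval_true r (y : lcells r) :
  (y ord_max).2 -> realval y = phi r (lvchain G (base y)) + climb y.
Proof. by rewrite /realval => ->. Qed.

Lemma realval_bnd r (y : lcells r.+1) : admissible y ->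
  bnd (singular R G X) r (realval y) = \sum_(i < r.+2) (-1) ^+ i *: realval (oface i y).
Proof.
move=> yadm; have [k [s [u [suy y_mono yA]]]] := yadm.
rewrite (alt_sum_lift_max (fun i => realval (oface i y))) -/(ofront y).
have [ymax|/negbTE ymax] := boolP (y ord_max).2; last first.
  have yE a : (y a).2 = false.
    have := leq_ord a; rewrite leq_eqVlt => /orP[/eqP aE|am].
      by have -> : a = ord_max by exact: val_inj.
    by have := y_mono a ord_max am; rewrite ymax implybF => /negbTE.
  rewrite [realval y]realval_false // (morph_lvchain psi suy).
  rewrite [realval (ofront y)]realval_false; last by rewrite ofrontE.
  by under [in RHS]eq_bigr => i _ do rewrite realval_false ?oface_max //.
rewrite [realval y]realval_true // linearD (morph_lvchain phi suy).
rewrite -addrA [_ *: _ + _]addrC.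
(* [phi] on the front face is traded for [realval] there: if that face ends at the top the climbs
   cancel, and if it lies at the bottom [D] passes from [phi] to [psi]. *)
have -> : bnd (singular R G X) r (climb y) + (-1) ^+ r.+1 *: phi r (lvchain G (base (ofront y)))
  = \sum_(i < r.+1) (-1) ^+ i *: climb (oface (lift ord_max i) y)
    + (-1) ^+ r.+1 *: realval (ofront y).
  have [fmax|fmax] := boolP (ofront y ord_max).2.
    rewrite climbS fmax linear0 add0r realval_true // scalerDr addrCA climb_bnd_true //.
    by rewrite addr0.
  by rewrite (climb_bnd_false yadm ymax fmax) (realval_false (negbTE fmax)).
rewrite addrA -big_split; congr (_ + _); apply: eq_bigr => i _.
by rewrite [in RHS]realval_true ?oface_max // scalerDr.
Qed.

End Formula.

(** * The complex of the prism and the complex of carriers *)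

Section Complexes.
Variables (R : realType) (Y : topologicalType) (A : set Y).

Local Notation V := (cell R Y * bool)%type.

(* Orders the vertices of every simplex of the complex [chains] below. *)
Definition rank (v : V) : nat := (#|cflag v.1| + v.2)%N.

Definition level_le k (c : V -> {set {set 'I_k.+1}}) (v w : V) : bool :=
  (c v \subset c w) && (v.2 ==> w.2).

(* The chains in the product of the poset of flags of one singular simplex [s] with
   [{false < true}]; those that meet both levels are required to lie over [A]. *)
Definition chain_simplices : set {fset V} := [set t | t != fset0 /\
  exists k (s : singularSimplex R Y k) (c : V -> {set {set 'I_k.+1}}),
    [/\ forall v, v \in t -> flag (c v) /\ v.1 = vert s (c v),
        forall v w, v \in t -> w \in t -> level_le c v w || level_le c w v &
        in_sub A s \/ forall v w, v \in t -> w \in t -> v.2 = w.2]].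

(** With no condition on order or levels, all vertices over the faces of one [s] can be taken
    together. The middle condition keeps each vertex among those of [chains]. *)
Definition carrier_simplices : set {fset V} := [set t | t != fset0 /\
  (forall v, v \in t -> exists k (s : singularSimplex R Y k) F,
     flag F /\ v.1 = vert s F) /\
  exists k (s : singularSimplex R Y k), forall v, v \in t -> is_face (csimp v.1) s].

Lemma chain_simplices_sub t t' : chain_simplices t -> (t' `<=` t)%fset ->
  t' != fset0 -> chain_simplices t'.
Proof.
move=> [_ [k [s [c [tc t_chain tA]]]]] /fsubsetP t't t'0; split=> //.
exists k, s, c; split.
- by move=> v /t't/tc.
- by move=> v w /t't vt /t't wt; exact: t_chain.
- by case: tA => [|tl]; [left | right=> v w /t't vt /t't wt; exact: tl].
Qed.

Lemma carrier_simplices_sub t t' : carrier_simplices t -> (t' `<=` t)%fset ->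
  t' != fset0 -> carrier_simplices t'.
Proof.
move=> [_ [tv [k [s ts]]]] /fsubsetP t't t'0; split=> //; split.
  by move=> v /t't/tv.
by exists k, s => v /t't/ts.
Qed.

Definition chains : simplicialComplex V :=
  {| simplices := chain_simplices;
     simplices_neq0 := fun _ => @proj1 _ _;
     simplices_sub := chain_simplices_sub |}.

Definition carriers : simplicialComplex V :=
  {| simplices := carrier_simplices;
     simplices_neq0 := fun _ => @proj1 _ _;
     simplices_sub := carrier_simplices_sub |}.

Lemma vert_face k (s : singularSimplex R Y k) F :
  flag F -> is_face (csimp (vert s F)) s.
Proof. by move=> /flag_cover_neq0/(vertP s)[g [gi sE _ _]]; exists g. Qed.

Lemma chains_sub_carriers : chains `<=` carriers.
Proof.
move=> t [t0 [k [s [c [tc _ _]]]]]; split=> //; split=> [v /tc[cflag ->]|].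
  by exists k, s, (c v).
by exists k, s => v /tc[cflag ->]; exact: vert_face.
Qed.

Lemma vertices_carriers : vertices carriers `<=` vertices chains.
Proof.
move=> v [_ [vv _]]; have [|k [s [F [Fflag vE]]]] := vv v; first by rewrite inE.
split; first by apply/fset0Pn; exists v; rewrite inE.
exists k, s, (fun=> F); split.
- by move=> w; rewrite inE => /eqP ->.
- by move=> w w'; rewrite !inE => /eqP -> /eqP ->; rewrite /level_le subxx implybb.
- by right=> w w'; rewrite !inE => /eqP -> /eqP ->.
Qed.

Lemma rank_flag k (s : singularSimplex R Y k) F e :
  flag F -> rank (vert s F, e) = (#|F| + e)%N.
Proof. by move=> /flag_cover_neq0 F0; rewrite /rank card_cflag. Qed.

Lemma rankE k (s : singularSimplex R Y k) F v :
  flag F -> v.1 = vert s F -> rank v = (#|F| + v.2)%N.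
Proof. by case: v => r e /= Fflag ->; exact: rank_flag. Qed.

(** On comparable vertices the size of the flag and the level both grow weakly, so equal sums force
    equality of each. *)
Lemma rank_inj t : simplices chains t ->
  forall v w, v \in t -> w \in t -> rank v = rank w -> v = w.
Proof.
move=> [_ [k [s [c [tc t_chain _]]]]].
suff H v w : v \in t -> w \in t -> level_le c v w -> rank v = rank w -> v = w.
  move=> v w vt wt vw; have /orP[h|h] := t_chain _ _ vt wt; first exact: (H v w).
  exact/esym/(H w v).
move=> vt wt /andP[cvw lvw]; have [vf vE] := tc _ vt; have [wf wE] := tc _ wt.
rewrite (rankE vf vE) (rankE wf wE) => rvw; have cc := subset_leq_card cvw.
have vw2 : v.2 = w.2.
  move: lvw rvw; case: v.2; case: w.2 => //= _; rewrite addn0 addn1 => h.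
  by rewrite h ltnn in cc.
have cvwE : c v = c w.
  move: rvw; rewrite vw2 => /addIn vwc.
  by apply/eqP; rewrite finset.eqEcard cvw vwc /=.
by rewrite (surjective_pairing v) (surjective_pairing w) vE wE cvwE vw2.
Qed.

Lemma vset_mem k (y : oseq V k) a : y a \in vset y.
Proof. by apply/imfsetP; exists a. Qed.

Lemma chains_admissible k (y : oseq V k) :
  simplices chains (vset y) -> ranked rank y -> admissible A y.
Proof.
move=> [_ [j [s [c [tc t_chain tA]]]]] y_ranked.
have y_le (a b : 'I_k.+1) : (a < b)%N -> level_le c (y a) (y b).
  move=> ab; have /orP[//|/andP[cba lba]] := t_chain _ _ (vset_mem y a) (vset_mem y b).
  have [af aE] := tc _ (vset_mem y a); have [bf bE] := tc _ (vset_mem y b).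
  have := y_ranked _ _ ab; rewrite (rankE af aE) (rankE bf bE).
  move=> ltab; suff : (#|c (y b)| + (y b).2 <= #|c (y a)| + (y a).2)%N.
    by rewrite leqNgt ltab.
  rewrite leq_add ?subset_leq_card //.
  by move: lba; case: (y a).2; case: (y b).2.
exists j, s, [ffun a => c (y a)]; split.
- split; first split=> [a|a b /y_le].
  + by rewrite ffunE; have [] := tc _ (vset_mem y a).
  + by rewrite !ffunE => /andP[].
  + by move=> a; rewrite !ffunE; have [] := tc _ (vset_mem y a).
- by move=> a b /y_le/andP[].
- by case: tA => [|tl]; [left | right=> a b; apply: tl; exact: vset_mem].
Qed.

Lemma chains_intro k (s : singularSimplex R Y k) r (y : oseq V r)
    (f : 'I_r.+1 -> {set {set 'I_k.+1}}) :
  (forall a, flag (f a) /\ (y a).1 = vert s (f a)) ->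
  (forall a b : 'I_r.+1, (a < b)%N -> f a \subset f b /\ ((y a).2 ==> (y b).2)) ->
  (in_sub A s \/ forall a b, (y a).2 = (y b).2) ->
  simplices chains (vset y).
Proof.
move=> yf y_mono yA.
pose c v := f (odflt ord0 [pick a | y a == v]).
have cE v : v \in vset y -> exists2 a, c v = f a & v = y a.
  move=> /imfsetP[/= a _ ->]; rewrite /c; case: pickP => [b /eqP yb|] /=.
    by exists b.
  by move=> /(_ a); rewrite eqxx.
split; first by apply/fset0Pn; exists (y ord0); exact: vset_mem.
exists k, s, c; split.
- by move=> v /cE[a -> ->]; exact: yf.
- move=> v w /cE[a cva va] /cE[b cwb wb]; rewrite /level_le cva cwb va wb.
  case: (ltngtP a b) => [/y_mono[-> ->] //|/y_mono[-> ->]|/val_inj ->].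
    by rewrite orbT.
  by rewrite subxx implybb.
- case: yA => [|yl]; [by left | right=> v w /cE[a _ ->] /cE[b _ ->]; exact: yl].
Qed.

End Complexes.

Section Realization.
Variables (R : realType) (G : comNzRingType) (Y X : topologicalType) (A : set Y).
Variables phi psi : chainMorphism (singular R G Y) (singular R G X).
Variable D : chainHomotopy (cmor_comp phi (singular_incl R G A))
                           (cmor_comp psi (singular_incl R G A)).

Local Notation V := (cell R Y * bool)%type.
Local Notation L := (chains R A).
Local Notation K := (carriers R Y).

Definition real_map k : oriented G L k -> singular R G X k :=
  antisym (@rank R Y) (@realval R G Y X A phi psi D k).
HB.instance Definition _ k := GRing.Linear.on (@real_map k).

Lemma overtex_chains k (s : orderedSimplex L k) : simplices L (vset s).
Proof. by case: s => s /= /andP[_ /asboolP]. Qed.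

Lemma real_map_ranked k (s : orderedSimplex L k) :
  ranked (@rank R Y) s -> real_map (ochain G s) = realval D (s : oseq V k).
Proof. exact: antisym_ranked. Qed.

Lemma real_map_bnd k (c : oriented G L k.+1) :
  bnd (singular R G X) k (real_map c) = real_map (bnd (oriented G L) k c).
Proof.
pose f := bnd (singular R G X) k \o @real_map k.+1 : {linear _ -> _}.
pose g := @real_map k \o bnd (oriented G L) k : {linear _ -> _}.
rewrite -[LHS]/(f c) -[RHS]/(g c); apply: oriented_linP => s.
(* [real_map] is explicit on the ranked ordering, and faces of a ranked ordering are ranked. *)
have [p pr] := ranked_exists (rank_inj (overtex_chains s)).
rewrite (ochain_permE G p s) !linearZ; congr (_ *: _).
move: (ord_perm p s) pr => {}s s_ranked; rewrite /f /g /=.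
rewrite (real_map_ranked s_ranked) realval_bnd; last first.
  exact: chains_admissible (overtex_chains s) s_ranked.
rewrite bnd_ochain linear_sum; apply: eq_bigr => i _; rewrite linearZ /=.
rewrite real_map_ranked // => a b ab; rewrite !ffunE.
exact/s_ranked/incr_lift.
Qed.

Lemma ranked0 (y : oseq V 0) : ranked (@rank R Y) y.
Proof. by move=> a b; rewrite [a]ord1 [b]ord1. Qed.

Lemma realval0 (s : orderedSimplex L 0) : exists t : singularSimplex R Y 0,
  real_map (ochain G s) = if (s ord0).2 then phi 0 (schain G t) else psi 0 (schain G t).
Proof.
have sr : ranked (@rank R Y) s by exact: ranked0.
have [k [t [u [stu _ _]]]] := chains_admissible (overtex_chains s) sr.
rewrite real_map_ranked // /realval addr0 (lvchainE G stu) /nsimp.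
rewrite asboolT; last by move=> a b; rewrite [a]ord1 [b]ord1.
by exists (sing_pull (oseq_map (@lastv k) u) t); rewrite [ord_max]ord1.
Qed.

Lemma real_map_aug (c : oriented G L 0) :
  aug (singular R G X) (real_map c) = aug (oriented G L) c.
Proof.
apply: (oriented_linP (f := aug (singular R G X) \o @real_map 0)
                      (g := aug (oriented G L))) => s.
rewrite -[LHS]/(aug (singular R G X) (real_map (ochain G s))).
have [t ->] := realval0 s; rewrite aug_ochain.
by case: ifP => _; rewrite cmor_aug /schain [LHS]alt_augU.
Qed.

Definition realization : chainMorphism (oriented G L) (singular R G X) :=
  {| cmor := fun k => @real_map k;
     cmor_bnd := real_map_bnd;
     cmor_aug := real_map_aug |}.

Lemma realization_correct :
  correct phi -> correct psi -> correct_oriented realization.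
Proof.
by move=> phi_c psi_c s /=; have [t ->] := realval0 s; case: ifP.
Qed.

Section Smallness.
Variables (k : nat) (s : singularSimplex R Y k) (B : set X).
Hypothesis phi_B : forall j (t : singularSimplex R Y j), is_face t s ->
  carrier (phi j (schain G t)) `<=` B.
Hypothesis psi_B : forall j (t : singularSimplex R Y j), is_face t s ->
  carrier (psi j (schain G t)) `<=` B.
Hypothesis D_B : forall j (a : singularSimplex R (set_type A) j),
  is_face (push_sub a) s -> carrier (D j (schain G a)) `<=` B.

Lemma subhom_carrier j (t : singularSimplex R Y j) :
  is_face t s -> carrier (subhom D << t >>) `<=` B.
Proof.
move=> ts; have [[a tE]|tA] := pselect (in_sub A t).
  by rewrite tE subhom_push; apply: D_B; rewrite -tE.
rewrite /subhom linextU; case: pselect => // _; exact: carrier_sub0.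
Qed.

Lemma lvchain_carrier r (y : oseq (cell R Y) r) m
    (h : {linear {malg G[singularSimplex R Y r]} -> singular R G X m}) :
  is_face (csimp (y ord_max)) s ->
  (forall t, is_face t s -> carrier (h << t >>) `<=` B) ->
  carrier (h (lvchain G y)) `<=` B.
Proof.
move=> ys hB; apply: (carrier_sub_linear (h := h) (lvchain_supp (G := G) (y := y))) => _ [g gi ->].
apply: hB; apply: is_face_trans ys; by exists g.
Qed.

Lemma realval_carrier r (y : oseq V r) :
  (forall a, is_face (csimp (y a).1) s) -> carrier (realval D y) `<=` B.
Proof.
move=> ys; have ysmax : is_face (csimp (base y ord_max)) s by rewrite ffunE.
rewrite /realval; case: ifP => _; last exact: (lvchain_carrier (h := psi r) ysmax (@psi_B r)).
apply: carrier_subD; first exact: (lvchain_carrier (h := phi r) ysmax (@phi_B r)).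
case: r y ys {ysmax} => [|r] y ys; first exact: carrier_sub0.
rewrite climbS; case: ifP => _; first exact: carrier_sub0.
apply: carrier_subZ; apply: (lvchain_carrier (h := @subhom R G Y X A phi psi D r)); last exact: subhom_carrier.
by rewrite !ffunE.
Qed.

Lemma real_map_carrier r (t : orderedSimplex L r) :
  (forall v, v \in vset t -> is_face (csimp v.1) s) ->
  carrier (real_map (ochain G t)) `<=` B.
Proof.
move=> ts; rewrite /real_map antisymE; apply: carrier_sub_sum => p _.
apply: carrier_subZ; case: ifP => _; last exact: carrier_sub0.
by apply: realval_carrier => a; rewrite ffunE; apply: ts; exact: vset_mem.
Qed.

End Smallness.

(** For a face of [s] in [A], smallness of [D] gives a member [B'] that also contains [phi] of a
    vertex of the face. That carrier is nonempty and lies in [B], so [B'] meets [B] and is contained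
    in [C], which serves all faces at once. *)
Lemma realization_partial (W U : set (set X)) :
  (forall B, W B -> exists2 C, U C & forall B', W B' -> B' `&` B !=set0 -> B' `<=` C) ->
  correct phi -> cover_close W phi psi -> cover_small W D ->
  partial_realization U K realization.
Proof.
move=> WU phi_c phipsi D_small; split.
- exact: chains_sub_carriers.
- exact: vertices_carriers.
- move=> t [_ [_ [k [s ts]]]].
  have [B WB phipsiB] := phipsi _ s; have [C UC WC] := WU _ WB; exists C => //.
  have vertex_B (v : singularSimplex R Y 0) : is_face v s ->
      carrier (phi 0 (schain G v)) `<=` B /\ carrier (phi 0 (schain G v)) !=set0.
    move=> vs; split; first by move=> x vx; apply: (phipsiB _ _ vs); left.
    by have [x ->] := phi_c v; exact: carrier_schain_neq0.
  (* [B] is itself one of the members meeting [B], as it contains a nonempty carrier. *)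
  have BC : B `<=` C.
    have [vB [x vx]] := vertex_B _ (is_face_vertex s).
    by apply: WC => //; exists x; split; exact: vB.
  move=> r y yt; apply: (real_map_carrier (s := s)).
  + by move=> j b bs x bx; apply/BC/(phipsiB _ _ bs); left.
  + by move=> j b bs x bx; apply/BC/(phipsiB _ _ bs); right.
  + move=> j a as_; have [B' WB' aB'] := D_small _ a.
    have aB'v := aB' _ _ _ (is_face_refl a) (is_face_vertex a).
    apply: subset_trans (WC _ WB' _) => [x ax|]; first by apply: aB'v; left; left.
    pose v := push_sub (sing_pull (fun _ : 'I_1 => ord0) a).
    have va : is_face v (push_sub a).
      have -> : v = sing_pull (fun=> ord0) (push_sub a) by exact/continuousEP.
      exact: is_face_vertex.
    have [vB [x vx]] := vertex_B v (is_face_trans va as_).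
    exists x; split; last exact: vB.
    by apply: aB'v; left; right; rewrite /= singular_incl_gen.
  + by move=> v vy; apply: ts; exact: (fsubsetP yt).
Qed.

End Realization.

(** * The homotopy *)

Section Homotopy.
Variables (R : realType) (G : comNzRingType) (Y X : topologicalType) (A : set Y).
Variables phi psi : chainMorphism (singular R G Y) (singular R G X).
Variable D : chainHomotopy (cmor_comp phi (singular_incl R G A))
                           (cmor_comp psi (singular_incl R G A)).

Local Notation V := (cell R Y * bool)%type.
Local Notation L := (chains R A).
Local Notation K := (carriers R Y).

Lemma alpha_supp k (s : singularSimplex R Y k) :
  supp_in (fun y : oseq (cell R Y) k => exists2 u, represents s u y &
      forall a b : 'I_k.+1, (a < b)%N -> u a \proper u b)
    (alpha << s >> : {malg G[oseq _ _]}).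
Proof.
rewrite alpha_gen; apply: (supp_in_map (sdsd_supp (@ident_inj k))) => u [un ui].
by exists u => //; split=> // a; rewrite ffunE.
Qed.

(** The collapse of [nsimp_subdivision], read on cells: [alpha] is undone exactly, so no correction
    is due over [A] or at the two ends. *)
Lemma lvchain_alpha k (s : singularSimplex R Y k) :
  linext (fun y => lvchain G y) (alpha << s >>) = << s >>.
Proof.
rewrite alpha_gen /alphaU /opush [LHS]linear_linext -[RHS]nsimp_subdivision.
apply: (eq_linext_in (sdsd_supp (@ident_inj k))) => u [un _].
rewrite /= linextU; apply: lvchainE; split=> // a.
by rewrite ffunE.
Qed.

Lemma ranked_inj k (y : oseq V k) : ranked (@rank R Y) y -> injective y.
Proof.
move=> yr a b yab; apply: val_inj.
by case: (ltngtP a b) => // /yr; rewrite yab ltnn.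
Qed.

Lemma osimp_carriers k (s : singularSimplex R Y k) r (z : oseq V r)
    (f : 'I_r.+1 -> {set {set 'I_k.+1}}) :
  (forall a, flag (f a) /\ (z a).1 = vert s (f a)) -> ranked (@rank R Y) z ->
  osimp K z.
Proof.
move=> zf /ranked_inj/injectiveP zi; rewrite /osimp zi; apply/asboolP.
split; first by apply/fset0Pn; exists (z ord0); exact: vset_mem.
split=> [_ /imfsetP[a _ ->]|].
  by have [fa za] := zf a; exists k, s, (f a).
exists k, s => _ /imfsetP[a _ ->]; have [fa ->] := zf a; exact: vert_face.
Qed.

Lemma level_ranked k (s : singularSimplex R Y k) r u (y : oseq (cell R Y) r) e :
  represents s u y -> (forall a b : 'I_r.+1, (a < b)%N -> u a \proper u b) ->
  ranked (@rank R Y) (oseq_map (level e) y).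
Proof.
move=> [[uf _] yE] ui a b ab; rewrite !ffunE !yE !rank_flag // ltn_add2r.
exact/proper_card/ui.
Qed.

(** At each step either the flag grows strictly and the level does not drop, or the flag stays and
    the level rises. *)
Lemma prism_ranked k (s : singularSimplex R Y k) r u (y : oseq (cell R Y) r) z f :
  represents s u y -> (forall a b : 'I_r.+1, (a < b)%N -> u a \proper u b) ->
  prism_of y z f ->
  (forall a, flag (u (f a)) /\ (z a).1 = vert s (u (f a))) /\ ranked (@rank R Y) z.
Proof.
move=> [[uf _] yE] ui [zE z_mono z_strict _].
have zf a : flag (u (f a)) /\ (z a).1 = vert s (u (f a)) by rewrite zE yE.
split=> // a b ab; have [fa za] := zf a; have [fb zb] := zf b.
rewrite (rankE fa za) (rankE fb zb); have [fab lab] := z_mono _ _ ab.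
have := z_strict _ _ ab; move: fab; rewrite leq_eqVlt => /orP[/eqP/val_inj fab|].
  by rewrite fab => /(_ erefl)/andP[/negbTE -> ->]; rewrite ltn_add2l.
move=> /ui/proper_card uab _; rewrite -addSn leq_add //.
by move: lab; case: (z a).2; case: (z b).2.
Qed.

Lemma alpha_prism_supp k (s : singularSimplex R Y k) :
  supp_in (fun z : oseq V k.+1 =>
      exists (u : oseq {set {set 'I_k.+1}} k) (f : 'I_k.+2 -> 'I_k.+1),
      [/\ nested u, forall a, (z a).1 = vert s (u (f a)),
          forall a b : 'I_k.+2, (a < b)%N -> (f a <= f b)%N /\ ((z a).2 ==> (z b).2) &
          ranked (@rank R Y) z])
    (prism (alpha << s >>) : {malg G[oseq _ _]}).
Proof.
apply: (supp_in_linext (alpha_supp (s := s))) => y [u uy ui].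
rewrite -prism_gen => z /prism_supp[f zf].
have [zE zr] := prism_ranked uy ui zf; have [_ z_mono _ _] := zf.
exists u, f; split=> //; first by case: uy.
by move=> a; have [] := zE a.
Qed.

Lemma alpha_prism_osimp k (s : singularSimplex R Y k) :
  supp_in (@osimp _ K k.+1) (prism (alpha << s >>) : {malg G[oseq _ _]}).
Proof.
move=> z /alpha_prism_supp[u [f [[uf _] zE _ zr]]].
apply: (osimp_carriers (s := s) (f := u \o f)) zr => a.
by split; [exact: uf | exact: zE].
Qed.

Variable Psi : chainMorphism (oriented G K) (singular R G X).
Hypothesis PsiE : extends (@chains_sub_carriers R Y A) Psi (realization D).

Lemma Psi_chains k (z : oseq V k) : simplices L (vset z) -> ranked (@rank R Y) z ->
  Psi k (toOriented K << z >>) = realval D z.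
Proof.
move=> Lz zr.
have zP : injectiveb z && `[< simplices L (vset z) >].
  by apply/andP; split; [exact/injectiveP/ranked_inj | exact/asboolP].
pose s : orderedSimplex L k := OrderedSimplex zP.
rewrite -[z]/(overtex (ord_incl (@chains_sub_carriers R Y A) s)) toOrientedU.
rewrite -oriented_incl_def_ochain -[LHS]/(Psi k (oriented_incl G _ k (ochain G s))).
by rewrite PsiE -[LHS]/(real_map D (ochain G s)) real_map_ranked.
Qed.

Lemma base_level r (y : oseq (cell R Y) r) e : base (oseq_map (level e) y) = y.
Proof. by apply/ffunP => a; rewrite !ffunE. Qed.

Lemma climb_level r (y : oseq (cell R Y) r) : climb D (oseq_map (level true) y) = 0.
Proof. by case: r y => // r y; rewrite climbS ofrontE ffunE. Qed.

Lemma Psi_level k (s : singularSimplex R Y k) e :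
  Psi k (toOriented K (opush (level e) (alpha << s >>)))
  = (if e then phi else psi) k << s >>.
Proof.
rewrite -[in RHS]lvchain_alpha.
apply: (eq_linear_in (h := Psi k \o @toOriented _ _ K k \o @opush _ _ _ (level e) k)
  (h' := (if e then phi else psi) k \o linext (fun y => lvchain G y))
  (alpha_supp (s := s))) => y [u uy ui] /=.
rewrite opushU linextU Psi_chains; last exact: level_ranked uy ui.
  rewrite /realval base_level [oseq_map _ _ _]ffunE; case: e => //=.
  by rewrite climb_level addr0.
apply: (chains_intro (s := s) (f := u)).
- by move=> a; rewrite ffunE; have [[uf _] yE] := uy; rewrite yE.
- by move=> a b ab; rewrite !ffunE implybb; have [[_ um] _] := uy; rewrite um.
- by right=> a b; rewrite !ffunE.
Qed.

(** A repeated cell under [z] kills the last-vertex chain, and a last but one vertex at the top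
    excludes the climb. *)
Lemma realval_collapse k (z : oseq V k.+1) (a b c : 'I_k.+2) : b = a.+1 :> nat ->
  (z a).1 = (z b).1 -> c.+1 = k.+1 -> (z c).2 -> realval D z = 0.
Proof.
move=> ab zab ck zc.
have z0 : lvchain G (base z) = 0.
  by apply: (@lvchain_repeat _ _ _ _ _ a b); rewrite ?ffunE // -val_eqE /= ab neq_ltn ltnSn.
have cE : c = lift ord_max ord_max by apply: val_inj; rewrite [RHS]lift_max; case: ck.
rewrite /realval z0 climbS ofrontE -cE zc !linear0 addr0.
by case: ifP.
Qed.

(** Over [A] the prism belongs to [L], where [Psi] is known; only the simplices that climb at the
    last vertex contribute, and the signs of [prism] and [climb] cancel. *)
Lemma Psi_prism k (s : singularSimplex R Y k) : in_sub A s ->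
  Psi k.+1 (toOriented K (prism (alpha << s >>))) = subhom D << s >>.
Proof.
move=> sA; pose N : {linear {malg G[oseq V k.+1]} -> _} := linext (@realval _ _ _ _ _ _ _ D k.+1).
transitivity (N (prism (alpha << s >>))).
  apply: (eq_linear_in (h := Psi k.+1 \o @toOriented _ _ K k.+1)
    (alpha_prism_supp (s := s))) => z [u [f [[uf um] zE z_mono zr]]].
  rewrite /N /= linextU Psi_chains //; apply: (chains_intro (s := s) (f := u \o f)).
  - by move=> a; split => //=.
  - move=> a b /z_mono[]; rewrite leq_eqVlt => /orP[/eqP/val_inj fab|/um uab] lab /=.
      by rewrite fab.
    by [].
  - by left.
rewrite -[in RHS]lvchain_alpha.
apply: (eq_linear_in (h := N \o @prism _ _ k) (h' := @subhom R G Y X A phi psi D k \o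
  linext (fun y => lvchain G y)) (alpha_supp (s := s))) => y [u uy ui] /=.
rewrite linextU prism_collapse => [|z a b c ab zab ck zc]; last first.
  by rewrite /N /= linextU; exact: realval_collapse ab zab ck zc.
rewrite /N /= linextU realval_true; last by rewrite ffunE unlift_none.
(* The last two vertices lie over the same cell, so the [phi] part vanishes and only the climb is
   left. *)
rewrite (@lvchain_repeat _ _ _ _ _ (lift ord_max ord_max) ord_max); first last.
- by rewrite !ffunE liftK unlift_none ffunE.
- by rewrite eq_sym neq_lift.
rewrite linear0 add0r climbS ofront_rcons ffunE /= base_level.
by rewrite scalerA -expr2 sqrr_sign scale1r.
Qed.

Definition homotopy k : singular R G Y k -> singular R G X k.+1 :=
  Psi k.+1 \o @toOriented _ _ K k.+1 \o @prism _ _ k \o @alpha R G Y k.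
HB.instance Definition _ k := GRing.Linear.on (@homotopy k).

Lemma homotopyE k (c : singular R G Y k) :
  homotopy c = Psi k.+1 (toOriented K (prism (alpha c))).
Proof. by []. Qed.

Lemma homotopy0 (s : singularSimplex R Y 0) :
  bnd (singular R G X) 0 (homotopy (schain G s))
  = phi 0 (schain G s) - psi 0 (schain G s).
Proof.
rewrite homotopyE cmor_bnd toOriented_bnd; last exact: alpha_prism_osimp.
rewrite prism_bnd0.
rewrite -[LHS]/((Psi 0 \o @toOriented _ _ K 0 : {linear _ -> _}) _) linearB.
exact: (congr2 (fun c d => c - d) (Psi_level s true) (Psi_level s false)).
Qed.

Lemma homotopyS k (s : singularSimplex R Y k.+1) :
  bnd (singular R G X) k.+1 (homotopy (schain G s))
  = phi k.+1 (schain G s) - psi k.+1 (schain G s)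
    - homotopy (bnd (singular R G Y) k (schain G s)).
Proof.
rewrite [homotopy (schain G s)]homotopyE cmor_bnd toOriented_bnd; last exact: alpha_prism_osimp.
rewrite prism_bndS alpha_bnd.
rewrite -[LHS]/((Psi k.+1 \o @toOriented _ _ K k.+1 : {linear _ -> _}) _) 2!linearB.
have E := congr2 (fun c d => c - d) (Psi_level s true) (Psi_level s false).
exact: (congr1 (fun c => c - homotopy (bnd (singular R G Y) k (schain G s))) E).
Qed.

Definition extension : chainHomotopy phi psi :=
  {| hmap := fun k => @homotopy k; hmap0 := homotopy0; hmapS := homotopyS |}.

Lemma extension_incl k (c : singular R G (set_type A) k) :
  extension k (singular_incl R G A k c) = D k c.
Proof.
apply: (linextP (f := @homotopy k \o singular_incl R G A k) (g := D k)) => a.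
rewrite -[<< a >>]/(schain G a) /= singular_incl_gen.
by rewrite -subhom_push; apply: Psi_prism; exists a.
Qed.

(** A singular simplex has finitely many flags of faces, so they fit into one simplex of [K], whose
    member of the cover serves all faces of [s]. *)
Definition face_vertices k (s : singularSimplex R Y k) : {fset V} :=
  [fset (vert s p.1, p.2) | p in [set p : {set {set 'I_k.+1}} * bool | `[< flag p.1 >]]%SET]%fset.

Lemma face_verticesP j k (h : 'I_j.+1 -> 'I_k.+1) (s : singularSimplex R Y k) F v :
  incr h -> flag F -> v.1 = vert (sing_pull h s) F -> v \in face_vertices s.
Proof.
move=> hi Fflag vE; apply/imfsetP; exists (gimg h F, v.2) => /=.
  by rewrite inE; apply/asboolP/(flag_gimgE _ hi).
rewrite -vert_gimg //; last exact: flag_cover_neq0.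
by rewrite -vE -surjective_pairing.
Qed.

Lemma face_vertices_carriers k (s : singularSimplex R Y k) :
  simplices K (face_vertices s).
Proof.
split; [|split].
- apply/fset0Pn; exists (vert s [set finset.setT]%SET, true).
  apply: (@face_verticesP _ _ id); [exact: incr_id| |by rewrite sing_pull_id].
  split.
  + by apply/finset.set0Pn; exists finset.setT; rewrite inE.
  + rewrite inE eq_sym; apply/finset.set0Pn; exists ord0; exact: finset.in_setT.
  + by move=> S T; rewrite !inE => /eqP -> /eqP ->; rewrite subxx.
- move=> _ /imfsetP[/= p + ->]; rewrite inE => /asboolP pf.
  by exists k, s, p.1.
- exists k, s => _ /imfsetP[/= p + ->]; rewrite inE => /asboolP pf.
  exact: vert_face.
Qed.

(** On any face of [s], the chains fed to [Psi] are combinations of simplices with vertices in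
    [face_vertices s]. *)
Lemma extension_small (U : set (set X)) :
  full_realization U Psi -> cover_small U extension.
Proof.
move=> [_ _ Psi_U] k s.
have [B UB sB] := Psi_U _ (face_vertices_carriers s); exists B => // j t v [h hi ->] [g gi ->].
have Psi_B i (l : 'I_i.+1 -> 'I_k.+1) r (z : oseq V r)
    (f : 'I_r.+1 -> {set {set 'I_i.+1}}) : incr l ->
    (forall a, flag (f a) /\ (z a).1 = vert (sing_pull l s) (f a)) ->
    ranked (@rank R Y) z -> carrier (Psi r (toOriented K << z >>)) `<=` B.
  move=> li zf zr; have Kz := osimp_carriers zf zr.
  rewrite -[z]/(overtex (OrderedSimplex Kz)) toOrientedU; apply: sB.
  apply/fsubsetP => _ /imfsetP[/= a _ ->]; have [fa za] := zf a.
  exact: face_verticesP li fa za.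
(* The values of [phi] and [psi] on vertices are values of [Psi] at the two ends, so they fall under
   the same bound. *)
have vertex_B e : carrier ((if e then phi else psi) 0 (schain G (sing_pull g s))) `<=` B.
  rewrite -[schain _ _]/(<< sing_pull g s >>) -Psi_level.
  apply: (carrier_sub_linear (h := Psi 0 \o @toOriented _ _ K 0 \o
    @opush _ _ _ (level e) 0) (alpha_supp (s := sing_pull g s))) => y [u uy ui].
  rewrite /= opushU; apply: (Psi_B _ g _ _ u gi).
    by move=> a; rewrite ffunE; have [[uf _] yE] := uy; rewrite yE.
  exact: level_ranked uy ui.
move=> x [[|]|]; [|exact: (vertex_B true)|exact: (vertex_B false)].
move: x; apply: (carrier_sub_linear (h := Psi j.+1 \o @toOriented _ _ K j.+1)
  (alpha_prism_supp (s := sing_pull h s))) => z [u [f [[uf _] zE _ zr]]].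
by apply: (Psi_B _ h _ _ (u \o f) hi) => // a; split; [exact: uf | exact: zE].
Qed.

End Homotopy.

Unset Implicit Arguments.

Theorem proposition2p4 (R : realType) (G : comNzRingType) (X : metricType R) :
  algebraic_ANR G X ->
  forall U : set (set X), open_cover U ->
  exists V : set (set X), [/\ open_cover V, refines V U &
    forall (Y : topologicalType) (A : set Y)
      (phi psi : chainMorphism (singular R G Y) (singular R G X))
      (D : chainHomotopy (cmor_comp phi (singular_incl R G A))
                         (cmor_comp psi (singular_incl R G A))),
    paracompact Y -> closed A ->
    correct phi -> correct psi -> cover_close V phi psi -> cover_small V D ->
    exists Phi : chainHomotopy phi psi, cover_small U Phi /\
      forall k (c : singular R G (set_type A) k),
        Phi k (singular_incl R G A k c) = D k c].
Proof.
move=> X_ANR U U_cover; have [V [V_cover VU V_real]] := X_ANR U U_cover.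
have [W [W_cover WV W_star]] := star_refinement V_cover.
exists W; split=> // [B /WV[B' /VU[B'' UB'' B'B''] BB']|].
  by exists B'' => //; exact: subset_trans B'B''.
move=> Y A phi psi D _ _ phi_c psi_c phipsi_close D_small.
have [||Psi [PsiE Psi_full]] := V_real _ (carriers R Y) (chains R A)
  (@chains_sub_carriers R Y A) (realization D).
- apply: (realization_partial (W := W)) => // B /W_star[C VC BC]; exists C => //.
  by move=> B' WB' B'B; apply: subset_trans BC => x B'x; exists B'.
- exact: realization_correct.
exists (extension PsiE); split; first exact: extension_small.
by move=> k c; exact: extension_incl.
Qed.
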